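(* Let $z\in X_d$ be the solution of the adjoint weak problem and $r=-(A\nabla z+bz+g_2)$. There exist constants $c_1,C_1>0$ such that for every $(\rho,v)\in\Sigma_d\times X_d$, $$c_1\,|||(r-\rho,z-v)|||\le\eta_d^{\mathrm{LS}}(\rho,v)\le C_1\,|||(r-\rho,z-v)|||.$$
   Context: Domain and coefficients: $\Omega\subset\mathbb R^d$, $d\ge2$, is a bounded Lipschitz domain with outward unit normal $n$ and $\partial\Omega=\overline{\Gamma_D}\cup\overline{\Gamma_N}$, where $\Gamma_D,\Gamma_N$ are disjoint relatively open subsets of $\partial\Omega$ and $|\Gamma_D|>0$. $A\in L^\infty(\Omega;\mathbb R^{d\times d})$ is symmetric with $a_0|\xi|^2\le\xi^TA(x)\xi\le a_1|\xi|^2$ for all $\xi\in\mathbb R^d$ and a.e. $x$, where $0<a_0\le a_1<\infty$; $b\in L^\infty(\Omega)^d$, $c\in L^\infty(\Omega)$. Data: $g_1\in L^2(\Omega)$, $g_2\in L^2(\Omega)^d$, $\psi_d\in L^2(\Gamma_N)$, $\phi_d\in H^{1/2}(\Gamma_D)$ (restrictions to $\Gamma_D$ of $H^{1/2}(\partial\Omega)$ functions). Notation: $(\cdot,\cdot)$ and $\|\cdot\|_0$ are the $L^2(\Omega)$ inner product and norm, $\|\cdot\|_1$ the $H^1(\Omega)$ norm, $\langle\cdot,\cdot\rangle_{\Gamma_N}$ the $L^2(\Gamma_N)$ pairing of traces. $H_D^1(\Omega)=\{v\in H^1(\Omega):v=0\text{ on }\Gamma_D\}$, $X_d=\{v\in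 H^1(\Omega):v=\phi_d\text{ on }\Gamma_D\}$. For $\rho\in H(\mathrm{div};\Omega)$ and $\psi\in L^2(\Gamma_N)$, ''$\rho\cdot n=\psi$ on $\Gamma_N$'' means $(\rho,\nabla s_0)+(\nabla\cdot\rho,s_0)=\langle\psi,s_0\rangle_{\Gamma_N}$ for all $s_0\in H_D^1(\Omega)$. $\Sigma_d=\{\rho\in H(\mathrm{div};\Omega):\rho\cdot n=\psi_d\text{ on }\Gamma_N\}$, assumed nonempty. $|||(\rho,v)|||^2=\|\rho\|_{H(\mathrm{div};\Omega)}^2+\|v\|_1^2$ with $\|\rho\|_{H(\mathrm{div};\Omega)}^2=\|\rho\|_0^2+\|\nabla\cdot\rho\|_0^2$. $a(t,s)=(A\nabla t,\nabla s)+(b\cdot\nabla t+ct,s)$, $m(w)=(g_1,w)-(g_2,\nabla w)-\langle\psi_d,w\rangle_{\Gamma_N}$ for $t,s,w\in H^1(\Omega)$. Standing assumption (inf-sup): there is $\beta>0$ with $\beta=\inf_{0\ne w_0\in H_D^1(\Omega)}\sup_{0\ne v_0\in H_D^1(\Omega)}\frac{a(w_0,v_0)}{\|w_0\|_1\|v_0\|_1}=\inf_{0\ne v_0\in H_D^1(\Omega)}\sup_{0\ne w_0\in H_D^1(\Omega)}\frac{a(w_0,v_0)}{\|w_0\|_1\|v_0\|_1}$. Adjoint weak problem: $z\in X_d$, $a(s_0,z)=m(s_0)$ for all $s_0\in H_D^1(\Omega)$. Estimator: $\eta_d^{\mathrm{LS}}(\rho,v)=\bigl(\|A^{-1/2}\rho+A^{1/2}\nabla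 v+A^{-1/2}bv+A^{-1/2}g_2\|_0^2+\|\nabla\cdot\rho+cv-g_1\|_0^2\bigr)^{1/2}$. *)

(* Defs.v *)
From HB Require Import structures.
From mathcomp Require Import all_boot all_order all_algebra.
From mathcomp Require Import all_classical all_reals all_analysis.
From mathcomp Require Import measurable_realfun.

Set Implicit Arguments.
Unset Strict Implicit.
Unset Printing Implicit Defensive.

Import Order.TTheory GRing.Theory Num.Theory.
Import numFieldNormedType.Exports.

Local Open Scope classical_set_scope.
Local Open Scope ring_scope.

Definition mx_borel_display : measure_display.
Proof. by []. Qed.

Section mx_borel.
Context (R : realType) (m n : nat).

Definition mx_borel : set (set 'M[R]_(m, n)) := <<s [set U | open U] >>.

Let mx_borel0 : mx_borel set0.
Proof. exact: sigma_algebra0. Qed.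

Let mx_borelC A : mx_borel A -> mx_borel (~` A).
Proof. exact: sigma_algebraC. Qed.

Let mx_borel_bigcup (F : _^nat) : (forall i, mx_borel (F i)) ->
  mx_borel (\bigcup_i (F i)).
Proof. exact: sigma_algebra_bigcup. Qed.

HB.instance Definition _ := @isMeasurable.Build mx_borel_display
  'M[R]_(m, n) mx_borel mx_borel0 mx_borelC mx_borel_bigcup.

Lemma mx_open_measurable (U : set 'M[R]_(m, n)) : open U -> measurable U.
Proof. by move=> oU; exact: sub_sigma_algebra. Qed.

Lemma mx_open_bigcup_ball (U : set 'M[R]_(m, n)) : open U ->
  U = \bigcup_(p in [set p : 'M[rat]_(m, n) * nat |
        ball (map_mx ratr p.1 : 'M[R]_(m, n)) p.2.+1%:R^-1 `<=` U])
      ball (map_mx ratr p.1 : 'M[R]_(m, n)) p.2.+1%:R^-1.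
Proof.
move=> oU; apply/seteqP; split => [x Ux|x [p /= pU px]]; last exact: pU.
have /nbhs_ballP[e /= e0 eU] : nbhs x U by move: oU; rewrite openE; exact.
have [k ke] : exists k : nat, k.+1%:R^-1 < e / 2.
  exists (Num.truncn (e / 2)^-1).
  rewrite invf_plt ?posrE ?divr_gt0//.
  by rewrite truncnS_gt.
have k0 : (0 : R) < k.+1%:R^-1 by rewrite invr_gt0.
have qP i j : exists q : rat, ball (x i j) k.+1%:R^-1 (ratr q : R).
  have : x i j - k.+1%:R^-1 < x i j + k.+1%:R^-1.
    by rewrite ltrBlDr -addrA ltrDl addr_gt0.
  move=> /rat_in_itvoo[q]; rewrite in_itv /= => /andP[q1 q2]; exists q.
  by rewrite /ball /= ltr_distlC q1.
pose q : 'M[rat]_(m, n) := \matrix_(i, j) (sval (cid (qP i j))).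
have qx : ball (map_mx ratr q : 'M[R]_(m, n)) k.+1%:R^-1 x.
  apply: ball_sym; split => // i j; rewrite !mxE.
  by case: cid => /= ?.
exists (q, k) => //= y qy; apply: eU.
have := ball_triangle (ball_sym qx) qy.
apply: le_ball; rewrite [leRHS]splitr.
by apply: lerD; exact: ltW.
Qed.

Lemma measurable_fun_mx d (T : measurableType d) (f : T -> 'M[R]_(m, n)) :
  (forall i j, measurable_fun setT (fun t => f t i j)) ->
  measurable_fun setT f.
Proof.
move=> mf; apply: (@measurability _ _ _ _ setT f [set U | open U]) => // _ [U oU <-].
rewrite setTI (mx_open_bigcup_ball oU) bigcup_mkcond preimage_bigcup.
apply: countable_bigcupT_measurable => // p /=.
case: ifPn => _; last by rewrite preimage_set0.
set c : 'M[R]_(m, n) := map_mx _ _; set e := _^-1.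
have -> : f @^-1` ball c e = \bigcap_(ij in [set: 'I_m * 'I_n])
    ((fun t => f t ij.1 ij.2) @^-1` ball (c ij.1 ij.2) e).
  apply/seteqP; split => t /=.
    by move=> [_ h] [i j] _; exact: h.
  move=> h; split; first by rewrite invr_gt0.
  by move=> i j; exact: (h (i, j) I).
apply: fin_bigcap_measurable => // -[i j] _ /=.
rewrite -[X in measurable X]setTI; apply: mf => //.
by apply: open_measurable; exact: ball_open.
Qed.

End mx_borel.

Section lebesgue_rV.
Context (R : realType).

Definition rVcons n (p : measurableTypeR R * 'rV[R]_n) : 'rV[R]_n.+1 :=
  row_mx (p.1%:M : 'rV[R]_1) p.2.

Lemma rVconsl n p i (k : 'I_1) : @rVcons n p i (lshift n k) = p.1.
Proof.
rewrite /rVcons; apply: etrans (row_mxEl _ _ _ _) _.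
by rewrite mxE !ord1 eqxx mulr1n.
Qed.

Lemma rVconsr n p i (k : 'I_n) : @rVcons n p i (rshift 1 k) = p.2 i k.
Proof. exact: row_mxEr. Qed.

Fixpoint leb (n : nat) : set 'rV[R]_n -> \bar R :=
  match n with
  | 0%N => \d_(0 : 'rV[R]_0)
  | k.+1 => pushforward (@lebesgue_measure R \x @leb k)%E (@rVcons k)
  end.

Arguments leb : clear implicits.

Lemma measurable_coord m n i j :
  measurable_fun setT (fun M : 'M[R]_(m, n) => M i j).
Proof.
apply: (@measurability _ _ _ _ setT _ _ (RGenOpens.measurableE R)).
move=> _ [_ [a [b ->] <-]]; rewrite setTI; apply: mx_open_measurable.
apply: open_comp; last exact: interval_open.
by move=> x _; exact: coord_continuous.
Qed.

Lemma measurable_rVcons n : measurable_fun setT (@rVcons n).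
Proof.
apply: measurable_fun_mx => i j.
have [k ->|k ->] := @split_ordP 1 n j.
  under eq_fun do rewrite rVconsl.
  exact: measurable_fst.
under eq_fun do rewrite rVconsr.
by apply: (measurableT_comp (@measurable_coord _ _ _ _)); exact: measurable_snd.
Qed.

Lemma rVcons_ballE n (r : R) : 0 < r ->
  @rVcons n @^-1` ball 0 r = ball (0 : R) r `*` ball (0 : 'rV[R]_n) r.
Proof.
move=> r0; apply/seteqP; split => [[x y]|[x y]] /=.
  move=> [_ h]; split; [|split => // i j].
    by have := h 0 (lshift n (0 : 'I_1)); rewrite rVconsl !mxE.
  by have := h i (rshift 1 (j : 'I_n)); rewrite rVconsr !mxE.
move=> [hx [_ hy]]; split => // i j.
have [k ->|k ->] := @split_ordP 1 n j.
  by rewrite rVconsl !mxE.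
by rewrite rVconsr; have := hy i k; rewrite !mxE.
Qed.

Lemma leb_measure n :
  exists m : {sigma_finite_measure set 'rV[R]_n -> \bar R}, 
    leb n = m /\ forall k : nat, (m (ball 0%R k.+1%:R) < +oo)%E.
Proof.
elim: n => [|n [m [mE mfin]]].
  exists (\d_(0 : 'rV[R]_0) : {sigma_finite_measure set _ -> \bar R}).
  by split => // k; rewrite (le_lt_trans (probability_le1 _ _)) ?ltry//;
    apply: mx_open_measurable; exact: ball_open.
pose M : {measure set (measurableTypeR R * 'rV[R]_n) -> \bar R} :=
  (@lebesgue_measure R \x m)%E.
pose P : {measure set 'rV[R]_n.+1 -> \bar R} :=
  measure_function_pushforward__canonical__measure_function_Measure M
    (@measurable_rVcons n).
have PE : leb n.+1 = P by rewrite /= mE.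
have Pfin k : (P (ball 0%R k.+1%:R) < +oo)%E.
  rewrite /P /= /pushforward rVcons_ballE// product_measure1E//; last 2 first.
  - exact: measurable_ball.
  - by apply: mx_open_measurable; exact: ball_open.
  rewrite [X in (X * _)%E](_ : _ = (k.+1%:R *+ 2)%:E :> \bar R).
    by rewrite lte_mul_pinfty.
  exact: lebesgue_measure_ball.
have Psf : sigma_finite setT P.
  exists (fun k => ball 0%R k.+1%:R); last first.
    by move=> k; split => //; apply: mx_open_measurable; exact: ball_open.
  apply/esym/seteqP; split => // x _.
  exists (Num.truncn `|x|) => //.
  by rewrite -ball_normE /= sub0r normrN truncnS_gt.
pose S : {sigma_finite_measure set 'rV[R]_n.+1 -> \bar R} :=
  HB.pack (P : set _ -> \bar R) (Measure.class P)
    (@Measure_isSigmaFinite.Build _ _ _ P Psf).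
by exists S; split.
Qed.

Let leb0 n : leb n set0 = 0%E.
Proof. by have [m [-> _]] := leb_measure n; exact: measure0. Qed.

Let leb_ge0 n A : (0 <= leb n A)%E.
Proof. by have [m [-> _]] := leb_measure n; exact: measure_ge0. Qed.

Let leb_sigma_additive n : semi_sigma_additive (leb n).
Proof. by have [m [-> _]] := leb_measure n; exact: measure_semi_sigma_additive. Qed.

HB.instance Definition _ n :=
  isMeasure.Build _ _ _ (leb n) (leb0 n) (@leb_ge0 n) (@leb_sigma_additive n).

Let leb_sigma_finite n : sigma_finite setT (leb n).
Proof. by have [m [-> _]] := leb_measure n; exact: sigma_finiteT. Qed.

HB.instance Definition _ n :=
  @Measure_isSigmaFinite.Build _ _ _ (leb n) (leb_sigma_finite n).

End lebesgue_rV.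

Arguments leb : clear implicits.

Section euclid.
Context (R : realType) (d : nat).
Implicit Types u v : 'rV[R]_d.

Definition dot u v : R := \sum_(i < d) u 0 i * v 0 i.

Definition enorm u : R := Num.sqrt (dot u u).

Lemma le_norm_enorm u : `|u| <= enorm u.
Proof.
have e0 : 0 <= enorm u by exact: sqrtr_ge0.
rewrite /Num.norm/= mx_normE/= -[enorm u]/((NngNum e0)%:num) num_le.
apply/bigmax_leP; split; first by rewrite -num_le/=.
move=> [i j] _; rewrite -num_le/= ord1 -sqrtr_sqr ler_wsqrtr// expr2.
rewrite /dot (bigD1 j)//= lerDl; apply: sumr_ge0 => k _.
by rewrite -expr2 sqr_ge0.
Qed.

End euclid.

Section hausdorff.
Context (R : realType) (d s : nat).
Local Open Scope ereal_scope.
Implicit Types (A B F U X : set 'rV[R]_d) (e : R).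

Definition ediam F : \bar R :=
  ereal_sup [set (enorm (p.1 - p.2)%R)%:E | p in F `*` F].

(* The factor is the volume of the s-dimensional ball of diameter 1, so that
   the case s = d - 1 gives the usual surface measure.  Borel covers suffice:
   a set and its closure have the same diameter. *)
Definition hgauge e F : \bar R :=
  if `[< F = set0 >] then 0
  else if ediam F <= e%:E then
    leb R s [set y | (enorm y <= 2^-1)%R] * ediam F ^+ s
  else +oo.

Definition hausdorff A : \bar R :=
  ereal_sup [set mu_ext (hgauge e) A | e in [set e | (0 < e)%R]].

Lemma hgauge0 e : hgauge e set0 = 0.
Proof. by rewrite /hgauge asboolT. Qed.

Lemma hgauge_ge0 e F : 0 <= hgauge e F.
Proof.
rewrite /hgauge; case: asboolP => // /eqP/set0P[x Fx]; case: ifPn => // _.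
apply: mule_ge0; first exact: measure_ge0.
apply: expe_ge0; apply: ereal_sup_ubound.
exists (x, x) => //=.
by rewrite subrr /enorm /dot big1 ?sqrtr0// => i _; rewrite mxE mul0r.
Qed.

Lemma hgauge_le e e' F : (e' <= e)%R -> hgauge e F <= hgauge e' F.
Proof.
move=> ee; rewrite /hgauge; case: asboolP => // _; case: ifPn => h.
  by case: ifPn => // _; rewrite leey.
case: ifPn => // h'; exfalso; move: h.
by rewrite (le_trans h')// lee_fin.
Qed.

Let pre_ge0 e A : 0 <= mu_ext (hgauge e) A.
Proof. exact: (mu_ext_ge0 (hgauge_ge0 e)). Qed.

Let pre_le e e' A : (e' <= e)%R ->
  mu_ext (hgauge e) A <= mu_ext (hgauge e') A.
Proof.
move=> ee; apply: le_ereal_inf_tmp => _ [F FA <-].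
apply: (@le_trans _ _ (\sum_(k <oo) hgauge e (F k))).
  by apply: ereal_inf_lbound; exists F.
by apply: lee_nneseries => [n _ _|n _]; [exact: hgauge_ge0|exact: hgauge_le].
Qed.

Let pre_hausdorff e A : (0 < e)%R -> mu_ext (hgauge e) A <= hausdorff A.
Proof. by move=> e0; apply: ereal_sup_ubound; exists e. Qed.

Let hausdorff0 : hausdorff set0 = 0.
Proof.
apply/eqP; rewrite eq_le; apply/andP; split.
  apply: ge_ereal_sup => _ [e e0 <-].
  by rewrite (mu_ext0 (hgauge0 e) (hgauge_ge0 e)).
by apply: le_trans (@pre_hausdorff 1%R _ ltr01); exact: pre_ge0.
Qed.

Let hausdorff_ge0 A : 0 <= hausdorff A.
Proof. by apply: le_trans (@pre_hausdorff 1%R _ ltr01); exact: pre_ge0. Qed.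

Let le_hausdorff : {homo hausdorff : A B / A `<=` B >-> A <= B}.
Proof.
move=> A B AB; apply: ge_ereal_sup => _ [e e0 <-].
by apply: le_trans (pre_hausdorff B e0); exact: le_mu_ext.
Qed.

Let hausdorff_sigma_subadditive : sigma_subadditive hausdorff.
Proof.
move=> F; apply: ge_ereal_sup => _ [e e0 <-].
apply: (@le_trans _ _ (\sum_(i <oo) mu_ext (hgauge e) (F i))).
  exact: (mu_ext_sigma_subadditive (hgauge_ge0 e)).
by apply: lee_nneseries => [n _ _|n _]; [exact: pre_ge0|exact: pre_hausdorff].
Qed.

HB.instance Definition _ := isOuterMeasure.Build R _ hausdorff
  hausdorff0 hausdorff_ge0 le_hausdorff hausdorff_sigma_subadditive.

Let pre_separated e r A B : (0 < e)%R -> (e < r)%R ->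
  (forall x y, A x -> B y -> (r <= enorm (x - y))%R) ->
  mu_ext (hgauge e) A + mu_ext (hgauge e) B <= mu_ext (hgauge e) (A `|` B).
Proof.
move=> e0 er AB; apply: le_ereal_inf_tmp => _ [F [mF FAB] <-].
pose FI C k := if `[< F k `&` C !=set0 >] then F k else set0.
have FIm C k : measurable (FI C k) by rewrite /FI; case: asboolP.
have FIC C : C `<=` A `|` B -> C `<=` \bigcup_k FI C k.
  move=> CAB x Cx; have [k _ Fkx] := FAB _ (CAB _ Cx).
  by exists k => //; rewrite /FI asboolT//; exists x.
apply: (@le_trans _ _ (\sum_(k <oo) hgauge e (FI A k) +
                       \sum_(k <oo) hgauge e (FI B k))).
  by apply: leeD; apply: ereal_inf_lbound; (eexists; [split|reflexivity]) => //;
    apply: FIC => ?; [left|right].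
rewrite -nneseriesD; [|by move=> *; exact: hgauge_ge0..].
apply: lee_nneseries => [k _ _|k _].
  by apply: adde_ge0; exact: hgauge_ge0.
rewrite /FI; case: asboolP => [[x [Fx Ax]]|_]; last first.
  by rewrite hgauge0 add0e; case: ifPn => // _; rewrite hgauge0 hgauge_ge0.
case: asboolP => [[y [Fy By]]|_]; last by rewrite hgauge0 adde0.
suff -> : hgauge e (F k) = +oo by rewrite leey.
rewrite /hgauge; case: asboolP => [F0|_]; first by move: Fx; rewrite F0.
rewrite ifF//; apply/negbTE; rewrite -ltNge.
apply: (@lt_le_trans _ _ (enorm (x - y))%:E).
  by rewrite lte_fin (lt_le_trans er)//; exact: AB.
by apply: ereal_sup_ubound; exists (x, y).
Qed.

Lemma hausdorff_separated r A B : (0 < r)%R ->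
  (forall x y, A x -> B y -> (r <= enorm (x - y))%R) ->
  hausdorff A + hausdorff B <= hausdorff (A `|` B).
Proof.
move=> r0 AB.
have [->|fin] := eqVneq (hausdorff (A `|` B)) +oo; first by rewrite leey.
have Hfin C : C `<=` A `|` B -> hausdorff C \is a fin_num.
  move=> CAB; rewrite ge0_fin_numE//.
  by apply: le_lt_trans (le_hausdorff CAB) _; rewrite ltey.
have BAB : B `<=` A `|` B by move=> ?; right.
rewrite -leeBrDr; last exact: Hfin.
apply: ge_ereal_sup => _ [e1 e10 <-].
rewrite leeBrDr; last exact: Hfin.
have Pfin : mu_ext (hgauge e1) A \is a fin_num.
  rewrite ge0_fin_numE//; apply: le_lt_trans (pre_hausdorff A e10) _.
  by rewrite -ge0_fin_numE//; apply: Hfin => ?; left.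
rewrite addeC -leeBrDr//.
apply: ge_ereal_sup => _ [e2 e20 <-].
rewrite leeBrDr// addeC.
pose e := Num.min (Num.min e1 e2) (r / 2)%R.
have e0 : (0 < e)%R by rewrite !lt_min/= e10 e20 divr_gt0.
have er : (e < r)%R.
  by rewrite /e gt_min; apply/orP; right; rewrite ltr_pdivrMr// ltr_pMr// ltr1n.
apply: le_trans (pre_hausdorff _ e0).
apply: le_trans (pre_separated e0 er AB).
by apply: leeD; apply: pre_le; rewrite /e !ge_min lexx ?orbT.
Qed.

Lemma hausdorff_open_caratheodory U : open U -> hausdorff.-caratheodory U.
Proof.
move=> oU; apply: le_caratheodory_measurable => X.
have [Xoo|fin] := eqVneq (hausdorff X) +oo; first by rewrite [leRHS]Xoo leey.
have Xfin : hausdorff X < +oo by rewrite ltey.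
pose a n : R := (n.+1%:R^-1)%R.
have a0 n : (0 < a n)%R by rewrite invr_gt0.
have a_gap n : (0 < a n - a n.+1)%R.
  by rewrite subr_gt0 ltf_pV2 ?posrE// ltr_nat.
pose An n : set 'rV[R]_d := [set x | ball x (a n) `<=` U].
have AnS n : An n `<=` An n.+1.
  move=> x; rewrite /An /=; apply: subset_trans; apply: le_ball.
  by rewrite -subr_ge0 ltW.
pose Xn n := X `&` An n.
have XnX n : hausdorff (Xn n) <= hausdorff X by apply: le_hausdorff => ? [].
pose D k := Xn k.+2 `\` Xn k.+1.
have sep1 n x y : Xn n x -> (X `&` ~` U) y -> (a n <= enorm (x - y))%R.
  move=> [_ Ax] [_ Uy]; apply: le_trans (le_norm_enorm _).
  rewrite leNgt; apply/negP => xy; apply: Uy; apply: Ax.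
  by rewrite -ball_normE.
have claim1 n : hausdorff (Xn n) + hausdorff (X `&` ~` U) <= hausdorff X.
  apply: le_trans (hausdorff_separated (a0 n) (sep1 n)) _.
  by apply: le_hausdorff => x [[]|[]].
have sep2 n x y : Xn n x -> D n y -> (a n - a n.+1 <= enorm (x - y))%R.
  move=> [_ Ax] [[Xy _] XAy]; apply: le_trans (le_norm_enorm _).
  have : ~ An n.+1 y by move=> Ay; exact: XAy.
  rewrite leNgt => nAy; apply/negP => xy; apply: nAy => w.
  rewrite -ball_normE /= => yw; apply: Ax; rewrite -ball_normE /=.
  rewrite (_ : x - w = (x - y) + (y - w))%R; last by rewrite addrA subrK.
  rewrite (le_lt_trans (ler_normD _ _))//.
  by rewrite -(subrK (a n.+1) (a n)) ltrD.
have step n : hausdorff (Xn n) + hausdorff (D n) <= hausdorff (Xn n.+2).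
  apply: le_trans (hausdorff_separated (a_gap n) (sep2 n)) _.
  apply: le_hausdorff => x [[Xx Ax]|[]//].
  by split => //; exact: (AnS _ _ (AnS _ _ Ax)).
have parity j N : \sum_(k < N) hausdorff (D (k.*2 + j)%N) <=
    hausdorff (Xn (N.*2 + j)%N).
  elim: N => [|N ih]; first by rewrite big_ord0.
  by rewrite big_ord_recr/= doubleS !addSn (le_trans _ (step _))// leeD2r.
have split2 N : \sum_(k < N.*2) hausdorff (D k) =
    \sum_(k < N) hausdorff (D (k.*2 + 0)%N) +
    \sum_(k < N) hausdorff (D (k.*2 + 1)%N).
  elim: N => [|N ih]; first by rewrite !big_ord0 adde0.
  rewrite doubleS !big_ord_recr/= ih addn0 addn1.
  exact: etrans (esym (addeA _ _ _)) (addeACA _ _ _ _).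
have sumfin : \sum_(k <oo) hausdorff (D k) < +oo.
  apply: (@le_lt_trans _ _ (hausdorff X + hausdorff X)); last first.
    by rewrite lte_add_pinfty.
  apply: lime_le; first exact: is_cvg_nneseries.
  apply: nearW => N; rewrite big_mkord.
  apply: (@le_trans _ _ (\sum_(k < N.*2) hausdorff (D k))).
    rewrite -!(big_mkord xpredT (fun k => hausdorff (D k))).
    apply: lee_sum_nneg_natr => //; first by rewrite -addnn leq_addr.
  by rewrite split2 leeD// (le_trans (parity _ _)).
have tail := nneseries_tail_cvg sumfin (fun k _ => hausdorff_ge0 (D k)).
have claim3 n : hausdorff (X `&` U) <=
    hausdorff (Xn n.+1) + \sum_(n <= k <oo) hausdorff (D k).
  apply: (@le_trans _ _ (hausdorff
      (Xn n.+1 `|` \bigcup_(k in ~` `I_n) D k))); last first.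
    apply: (le_trans (outer_measureU2 hausdorff _ _)).
    by rewrite leeD2l//; exact: (outer_measure_sigma_subadditive_tail hausdorff).
  apply: le_hausdorff => x [Xx Ux].
  have [m Am] : exists m, An m x.
    have /nbhs_ballP[e /= e0 eU] : nbhs x U by move: oU; rewrite openE; exact.
    exists (Num.truncn e^-1) => y xy; apply: eU; move: xy; apply: le_ball.
    by rewrite /a invf_ple ?posrE// ltW// truncnS_gt.
  have [nm|mn] := leqP m n.+1.
    left; split => //; rewrite -(subnK nm); elim: (n.+1 - m)%N => // k.
    by rewrite addSn => ?; exact: AnS.
  have [|nAn] := pselect (An n.+1 x); first by left.
  right; move: mn Am nAn => /ltnW/subnK <-.
  elim: (m - n.+1)%N => [//|k ih]; rewrite addSn => Ak1 nAn.
  have [Ak|nAk] := pselect (An (k + n.+1)%N x); first exact: ih.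
  exists (k + n)%N; first by rewrite /= ltnNge leq_addl.
  by move: Ak1 nAk; rewrite addnS => Ak1 nAk; split => // -[].
rewrite -[leRHS]adde0.
apply: (cvge_ge (F := \oo) (f := fun n => hausdorff X +
    \sum_(n <= k <oo) hausdorff (D k))); last first.
  apply: cvgeD => //; last exact: cvg_cst.
  by rewrite fin_num_adde_defl.
apply: nearW => n; apply: le_trans (leeD2r _ (claim3 n)) _.
by rewrite addeAC leeD2r.
Qed.

Let hausdorff_measurable_caratheodory A :
  measurable A -> hausdorff.-caratheodory A.
Proof.
move: A; apply: smallest_sub; last exact: hausdorff_open_caratheodory.
split; first exact: caratheodory_measurable_set0.
  by move=> A mA; rewrite setTD; exact: caratheodory_measurable_setC.
exact: caratheodory_measurable_bigcup.
Qed.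

Let hausdorff_sigma_additive : semi_sigma_additive hausdorff.
Proof.
move=> F mF tF mUF.
apply: (@caratheodory_measure_sigma_additive _ _ hausdorff) => //.
- by move=> i; exact: hausdorff_measurable_caratheodory.
- exact: hausdorff_measurable_caratheodory.
Qed.

HB.instance Definition _ := isMeasure.Build _ _ _ hausdorff
  hausdorff0 hausdorff_ge0 hausdorff_sigma_additive.

End hausdorff.

Section spaces.
Context (R : realType) (d : nat).
Notation E := 'rV[R]_d.
Implicit Types (Om D : set E) (f g : E -> R) (F G : E -> E).

Definition L2 (mu : set E -> \bar R) D f :=
  measurable_fun D f /\ (\int[mu]_(x in D) ((f x) ^+ 2)%:E < +oo)%E.

Definition Linf (mu : set E -> \bar R) D f :=
  measurable_fun D f /\ exists M : R, \forall x \ae mu, D x -> `|f x| <= M.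

Definition L2vec D F := forall i, L2 (leb R d) D (fun x => F x 0 i).

Definition ip D f g : R := (\int[leb R d]_(x in D) (f x * g x))%R.

Definition ipvec D F G : R := (\int[leb R d]_(x in D) dot (F x) (G x))%R.

Definition basis_vec (i : 'I_d) : E := delta_mx 0 i.

Definition grad f : E -> E := fun x => \row_i 'D_(basis_vec i) f x.

Fixpoint Ck (k : nat) f : Prop :=
  match k with
  | 0%N => continuous f
  | j.+1 => continuous f /\
      forall i, (forall x, derivable f x (basis_vec i)) /\
                Ck j ('D_(basis_vec i) f)
  end.

Definition smooth f := forall k, Ck k f.

Definition test_fun Om f := smooth f /\
  exists K : set E, [/\ compact K, K `<=` Om & forall x, ~ K x -> f x = 0].

Definition is_weak_grad Om f G := forall phi, test_fun Om phi -> forall i,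
  ip Om f ('D_(basis_vec i) phi) = - ip Om (fun x => G x 0 i) phi.

Definition is_weak_div Om F g := forall phi, test_fun Om phi ->
  ipvec Om F (grad phi) = - ip Om g phi.

(* Weak gradients and divergences are unique up to null sets, so elements of
   H^1 and H(div) are represented by a function paired with its weak
   derivative. *)
Record H1 Om := MkH1 {
  h1_fun :> E -> R;
  h1_grad : E -> E;
  h1_fun_L2 : L2 (leb R d) Om h1_fun;
  h1_grad_L2 : L2vec Om h1_grad;
  h1_gradP : is_weak_grad Om h1_fun h1_grad }.

Record Hdiv Om := MkHdiv {
  hdiv_fun :> E -> E;
  hdiv_div : E -> R;
  hdiv_fun_L2 : L2vec Om hdiv_fun;
  hdiv_div_L2 : L2 (leb R d) Om hdiv_div;
  hdiv_divP : is_weak_div Om hdiv_fun hdiv_div }.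

Definition h1_norm Om (w : H1 Om) : R :=
  Num.sqrt (ip Om w w + ipvec Om (h1_grad w) (h1_grad w)).

(* |||(r - rho, z - v)|||, using div (r - rho) = div r - div rho and
   grad (z - v) = grad z - grad v. *)
Definition err_norm Om (r rho : Hdiv Om) (z v : H1 Om) : R :=
  let q x := r x - rho x in
  let dq x := hdiv_div r x - hdiv_div rho x in
  let w x := z x - v x in
  let dw x := h1_grad z x - h1_grad v x in
  Num.sqrt (ipvec Om q q + ip Om dq dq + (ip Om w w + ipvec Om dw dw)).

Definition bdry Om : set E := closure Om `\` Om^°.

Definition lipschitz_fun f :=
  exists L : R, forall x y, `|f x - f y| <= L * enorm (x - y).

(* Near each boundary point Om is the strict epigraph, in the direction of some
   unit vector e, of a Lipschitz function of the component orthogonal to e. *)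
Definition bounded_lipschitz_domain Om :=
  [/\ open Om, connected Om, Om !=set0, bounded_set Om &
   forall p, bdry Om p -> exists (e : E) (gam : E -> R) (r : R),
     [/\ enorm e = 1, lipschitz_fun gam, 0 < r &
      forall x, enorm (x - p) < r ->
        (Om x <-> gam (x - dot x e *: e) < dot x e)]].

Definition surf : set E -> \bar R := @hausdorff R d d.-1.
HB.instance Definition _ := Measure.on surf.

Definition rel_open (S G : set E) := exists U : set E, open U /\ G = S `&` U.

(* The values of t outside the boundary are irrelevant, and t is determined up
   to surf-null sets on a bounded Lipschitz domain: the trace operator is the continuous
   extension to H^1 of the restriction to the boundary of functions smooth up
   to the boundary, which are dense in H^1. *)
Definition is_trace Om (w : H1 Om) (t : E -> R) :=
  L2 surf (bdry Om) t /\
  exists u : nat -> E -> R,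
  [/\ forall n, smooth (u n),
      (\int[leb R d]_(x in Om) ((u n x - w x) ^+ 2)%R%:E)%E
        @[n --> \oo] --> 0%E,
      (\int[leb R d]_(x in Om) (enorm (grad (u n) x - h1_grad w x) ^+ 2)%R%:E)%E
        @[n --> \oo] --> 0%E &
      (\int[surf]_(x in bdry Om) ((u n x - t x) ^+ 2)%R%:E)%E
        @[n --> \oo] --> 0%E].

Definition eq_on Om (w : H1 Om) (phi : E -> R) (Gam : set E) :=
  exists t, is_trace w t /\ \forall x \ae surf, Gam x -> t x = phi x.

Definition H1D Om (GD : set E) : set (H1 Om) :=
  [set w | eq_on w (fun=> 0) GD].

Definition Xd Om (GD : set E) (phid : E -> R) : set (H1 Om) :=
  [set w | eq_on w phid GD].

(* Sobolev-Slobodeckij space H^(1/2); the boundary has dimension d - 1. *)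
Definition Hhalf_bdry Om g := L2 surf (bdry Om) g /\
  (\int[surf]_(x in bdry Om) \int[surf]_(y in bdry Om)
     ((g x - g y) ^+ 2 / enorm (x - y) ^+ d)%R%:E < +oo)%E.

Definition Hhalf Om (Gam : set E) (phi : E -> R) :=
  exists g, Hhalf_bdry Om g /\ \forall x \ae surf, Gam x -> phi x = g x.

Definition bdry_pairing (Gam : set E) (psi t : E -> R) : R :=
  (\int[surf]_(x in Gam) (psi x * t x))%R.

(* t is the trace of the test function s0. *)
Definition normal_trace Om (GD GN : set E) (rho : Hdiv Om) (psi : E -> R) :=
  forall s0 : H1 Om, H1D GD s0 -> forall t, is_trace s0 t ->
  ipvec Om rho (h1_grad s0) + ip Om (hdiv_div rho) s0 = bdry_pairing GN psi t.

Definition Sigmad Om (GD GN : set E) (psid : E -> R) : set (Hdiv Om) :=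
  [set rho | normal_trace GD GN rho psid].

(* Matrices act on row vectors as on the corresponding columns. *)
Definition mxact (M : 'M[R]_d) (v : E) : E := v *m M^T.

Definition psd (M : 'M[R]_d) := M^T = M /\ forall v, 0 <= dot v (mxact M v).

(* The principal square root, which exists and is unique when M is psd. *)
Definition sqrtmx (M : 'M[R]_d) : 'M[R]_d :=
  xget 0 [set S | psd S /\ S *m S = M].

Definition sqrtmxV (M : 'M[R]_d) : 'M[R]_d := invmx (sqrtmx M).

Definition elliptic Om (A : E -> 'M[R]_d) (a0 a1 : R) :=
  [/\ forall i j, Linf (leb R d) Om (fun x => A x i j),
      (\forall x \ae leb R d, Om x -> (A x)^T = A x),
      0 < a0, a0 <= a1 &
      \forall x \ae leb R d, Om x -> forall xi,
        a0 * dot xi xi <= dot xi (mxact (A x) xi) <= a1 * dot xi xi].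

Section forms.
Context (Om GD GN : set E).
Context (A : E -> 'M[R]_d) (b : E -> E) (c : E -> R).
Context (g1 : E -> R) (g2 : E -> E) (psid : E -> R).

Definition aform (t s : H1 Om) : R :=
  ipvec Om (fun x => mxact (A x) (h1_grad t x)) (h1_grad s) +
  ip Om (fun x => dot (b x) (h1_grad t x) + c x * t x) s.

(* tw is the boundary trace of w. *)
Definition mform (w : H1 Om) (tw : E -> R) : R :=
  ip Om g1 w - ipvec Om g2 (h1_grad w) - bdry_pairing GN psid tw.

Definition adjoint_solution (phid : E -> R) (z : H1 Om) :=
  Xd GD phid z /\
  forall s0 : H1 Om, H1D GD s0 -> forall t, is_trace s0 t ->
    aform s0 z = mform s0 t.

Definition H1D_nz : set (H1 Om) := [set w | H1D GD w /\ h1_norm w != 0].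

Definition aquot (w v : H1 Om) : \bar R :=
  (aform w v / (h1_norm w * h1_norm v))%:E.

Definition inf_sup (beta : R) :=
  [/\ 0 < beta,
      beta%:E = ereal_inf [set ereal_sup [set aquot w v | v in H1D_nz]
                          | w in H1D_nz] &
      beta%:E = ereal_inf [set ereal_sup [set aquot w v | w in H1D_nz]
                          | v in H1D_nz]].

Definition eta_res1 (rho : Hdiv Om) (v : H1 Om) (x : E) : E :=
  mxact (sqrtmxV (A x)) (rho x) + mxact (sqrtmx (A x)) (h1_grad v x) +
  mxact (sqrtmxV (A x)) (v x *: b x) + mxact (sqrtmxV (A x)) (g2 x).

Definition eta_res2 (rho : Hdiv Om) (v : H1 Om) (x : E) : R :=
  hdiv_div rho x + c x * v x - g1 x.

Definition eta_LS (rho : Hdiv Om) (v : H1 Om) : R :=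
  Num.sqrt (ipvec Om (eta_res1 rho v) (eta_res1 rho v) +
            ip Om (eta_res2 rho v) (eta_res2 rho v)).

End forms.

End spaces.

(* Main.v *)
Require Import Defs.
From mathcomp Require Import all_boot all_order all_algebra.
From mathcomp Require Import all_classical all_reals all_analysis.
From mathcomp Require Import measurable_realfun ring lra spectral complex.

Set Implicit Arguments.
Unset Strict Implicit.
Unset Printing Implicit Defensive.

Import Order.TTheory GRing.Theory Num.Theory.
Import numFieldNormedType.Exports.

Local Open Scope classical_set_scope.
Local Open Scope ring_scope.

(** Testing the adjoint equation with C_c^oo functions shows div r = g1 - c z,
    and then the equation itself is the normal-trace condition for r.  Put
    q = r - rho, w = z - v, y = q + A grad w + w b and e = div q + c w.  Then
    eta^2 = ||A^(-1/2) y||^2 + ||e||^2, so eta is equivalent to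
    (||y||^2 + ||e||^2)^(1/2), which gives the upper bound.  For the lower
    bound, w and the normal trace of q vanish on the respective parts of the
    boundary, so a(s, w) = (grad s, y) + (s, e) for all s in H^1_D, and the
    inf-sup condition yields beta ||w||_1 <= (||y||^2 + ||e||^2)^(1/2); finally
    q and div q are recovered from y, e and w. *)

(** * Integration by parts for Lebesgue measure on row vectors *)

(** A trace is a relation witnessed by an approximating sequence, and the inf-sup condition applies
    to z - v only once this difference is built as an element of H^1_D. The only traces constructed
    are differences of given ones and the zero trace of a test function. The latter requires a test
    function to lie in H^1 with its classical gradient, that is, integration by parts for the
    inductively defined measure [leb]. The other obstacle is the weight A^(-1/2). [sqrtmx] is a
    choice, meaningful only where A(x) is symmetric and elliptic, so a real positive root has to be
    shown to exist, and the comparison of weighted and unweighted residuals holds only almost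
    everywhere. It rests on A^(1/2) = A^(-1/2) A and on a0 |t|^2 <= |y|^2 <= a1 |t|^2 for t =
    A^(-1/2) y. The data g1, g2 and psi_d cancel in the differences, so the constants obtained
    depend only on a0, a1, beta and the bounds of b and c. *)

Section lebesgue_rV_theory.
Context (R : realType).

Lemma continuous_mx_measurable m n (f : 'M[R]_(m, n) -> R) :
  continuous f -> measurable_fun setT f.
Proof.
move=> cf; apply: (@measurability _ _ _ _ setT _ _ (RGenOpens.measurableE R)).
move=> _ [_ [a [b ->] <-]]; rewrite setTI; apply: mx_open_measurable.
by apply: open_comp; [move=> x _; exact: cf|exact: interval_open].
Qed.

Lemma closed_cball_rV n (M : R) : closed [set x : 'rV[R]_n | `|x| <= M].
Proof.
apply: (@preimage_closed _ _ (fun x : 'rV[R]_n => `|x|) [set y | y <= M]).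
  by move=> x _; exact: norm_continuous.
exact: closed_le.
Qed.

Lemma measurable_cball_rV n (M : R) : measurable [set x : 'rV[R]_n | `|x| <= M].
Proof.
rewrite -[X in measurable X]setCK; apply: measurableC.
by apply: mx_open_measurable; apply: closed_openC; exact: closed_cball_rV.
Qed.

Lemma leb_cball_lty n (M : R) : (leb R n [set x | `|x| <= M]%R < +oo)%E.
Proof.
have [m [mE mfin]] := leb_measure R n.
rewrite mE; apply: le_lt_trans (mfin (Num.truncn M)).
apply: le_measure; rewrite ?inE.
- exact: measurable_cball_rV.
- by apply: mx_open_measurable; exact: ball_open.
- move=> x /= xM; rewrite -ball_normE /= sub0r normrN.
  by rewrite (le_lt_trans xM)// truncnS_gt.
Qed.

Lemma integrable_bounded_support d (T : measurableType d)
    (mu : {measure set T -> \bar R}) (B : set T) (f : T -> R) (K : R) :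
  measurable B -> (mu B < +oo)%E -> measurable_fun setT f ->
  (forall x, `|f x| <= K) -> (forall x, ~ B x -> f x = 0) ->
  mu.-integrable setT (EFin \o f).
Proof.
move=> mB Bfin mf fK f0.
have : mu.-integrable B (EFin \o f).
  apply: measurable_bounded_integrable => //; first exact: measurable_funTS.
  exists K; split; first exact: num_real.
  by move=> M KM x _ /=; rewrite (le_trans (fK x))// ltW.
rewrite integrable_mkcond//; congr (_.-integrable _ _).
apply/funext => x; rewrite patchE; case: ifPn => // /negP.
by rewrite inE => /f0 /= ->.
Qed.

Lemma continuous_bounded_support n (f : 'rV[R]_n -> R) (M : R) :
  continuous f -> (forall x, M < `|x| -> f x = 0) ->
  exists K : R, forall x, `|f x| <= K.
Proof.
move=> cf f0.
have cB : compact [set x : 'rV[R]_n | `|x| <= M].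
  apply: bounded_closed_compact.
    by exists M; split; [exact: num_real|move=> r Mr x /= /le_trans; apply;
      exact: ltW].
  exact: closed_cball_rV.
have [K [_ KP]] : bounded_set (f @` [set x : 'rV[R]_n | `|x| <= M]).
  apply: compact_bounded; apply: continuous_compact => //.
  exact: continuous_subspaceT.
(* [bounded_set] gives a bound only by numbers above K; the 0 covers the points outside the ball,
   which is empty when M < 0. *)
exists (Num.max (K + 1) 0) => x; rewrite le_max.
have [xM|/f0 ->] := leP `|x| M; last by rewrite normr0 lexx orbT.
by rewrite KP ?ltrDl//; exists x.
Qed.

(** Directional derivatives depend only on the restriction to a line. This carries partial
    derivatives on the whole space over to its slices. *)
Lemma derive_shift_congr (V W : normedModType R) (f : V -> R) (g : W -> R)
    (a v : V) (b w : W) :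
  (forall t, f (t *: v + a) = g (t *: w + b)) ->
  (derivable f a v = derivable g b w) * ('D_v f a = 'D_w g b).
Proof.
move=> fg.
have fgab : f a = g b by have := fg 0; rewrite !scale0r !add0r.
have E : (fun h => h^-1 *: ((f \o shift a) (h *: v) - f a)) =
         (fun h => h^-1 *: ((g \o shift b) (h *: w) - g b)).
  by apply/funext => h /=; rewrite fg fgab.
by rewrite /derivable /derive E.
Qed.

Lemma derive_support (V : normedModType R) (g : V -> R) (v : V) (M : R) (x :
  V) :
  (forall x, (M < `|x|) -> g x = 0) -> (M < `|x|) ->
  'D_v g x = 0.
Proof.
move=> g0 Mx.
have gx : {near x, g =1 cst 0}.
  by have := @norm_continuous _ _ x; move/cvgr_gt => /(_ _ Mx);
    apply: filterS => y; exact: g0.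
by rewrite (near_eq_derive _ gx) derive_cst.
Qed.

End lebesgue_rV_theory.

Section divergence.
Context (R : realType).
Local Open Scope ereal_scope.

(** [leb] in dimension n.+1 is a pushforward of a product measure; on the product side Fubini is
    available, and the first conclusion is its hypothesis. *)
Lemma leb_rVconsE n (f : 'rV[R]_n.+1 -> \bar R) :
  (leb R n.+1).-integrable setT f ->
  (@lebesgue_measure R \x leb R n).-integrable setT (f \o @rVcons R n) /\
  \int[leb R n.+1]_x f x =
    \int[@lebesgue_measure R \x leb R n]_p f (@rVcons R n p).
Proof.
move=> /integrableP[mf fi].
have mphi := @measurable_rVcons R n.
have fphi : (@lebesgue_measure R \x leb R n).-integrable setT
    (f \o @rVcons R n).
  apply/integrableP; split; first exact: measurableT_comp.
  apply: le_lt_trans fi.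
  have -> : \int[leb R n.+1]_x `|f x| =
      \int[pushforward (@lebesgue_measure R \x leb R n) (@rVcons R n)]_x `|f x|.
    exact: eq_measure_integral.
  rewrite (ge0_integral_pushforward mphi)//; last exact: measurableT_comp.
split => //.
have -> : \int[leb R n.+1]_x f x =
    \int[pushforward (@lebesgue_measure R \x leb R n) (@rVcons R n)]_x f x.
  exact: eq_measure_integral.
by rewrite (integral_pushforward mphi).
Qed.

Lemma rVcons_norm n (x : R) (y : 'rV[R]_n) :
  (`|x| <= `|rVcons (x, y)|)%R /\ (`|y| <= `|rVcons (x, y)|)%R.
Proof.
have coord m (v : 'rV[R]_m) i : (`|v 0%R i| <= `|v|)%R.
  rewrite [leRHS]/Num.Def.normr/= mx_normrE.
  exact: (le_bigmax _ (fun ij : 'I_1 * 'I_m => `|v ij.1 ij.2|%R) (0%R, i)).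
split.
  by have := coord _ (rVcons (x, y)) (lshift n (0%R : 'I_1)); rewrite rVconsl.
rewrite [leLHS]/Num.Def.normr/= mx_normrE bigmax_le// => -[i j] _ /=.
by have := coord _ (rVcons (x, y)) (rshift 1 j); rewrite rVconsr !ord1.
Qed.

Lemma continuous_rVconsl n (y : 'rV[R]_n) :
  continuous (fun x : R => rVcons (x, y)).
Proof.
move=> x; apply/cvg_ballP => e e0.
apply: filterS (nbhsx_ballx x e e0) => x' xx'.
split => // i j.
have [k ->|k ->] := @split_ordP 1 n j; first by rewrite !rVconsl.
by rewrite !rVconsr; exact: ballxx.
Qed.

Lemma continuous_rVconsr n (x : R) :
  continuous (fun y : 'rV[R]_n => rVcons (x, y)).
Proof.
move=> y; apply/(@cvg_ballP _ _ _ (nbhs y) (nbhs_filter y)) => e e0.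
apply: (@filterS _ (nbhs y) (nbhs_filter y) _ _ _
  (nbhsx_ballx y e e0)) => y' [_ yy'].
split => // i j.
have [k ->|k ->] := @split_ordP 1 n j; first by rewrite !rVconsl; exact: ballxx.
by rewrite !rVconsr; exact: yy'.
Qed.

Lemma rVcons_shiftl n (x t : R) (y : 'rV[R]_n) :
  (rVcons ((t *: 1 + x)%R, y) =
   t *: basis_vec R (lshift n (0 : 'I_1)) + rVcons (x, y))%R.
Proof.
apply/rowP => j; rewrite [RHS]mxE [X in _ = (X + _)%R]mxE.
have [k ->|k ->] := @split_ordP 1 n j.
  by rewrite !rVconsl mxE/= !ord1 eqxx.
by rewrite !rVconsr mxE eq_rlshift andbF mulr0 add0r.
Qed.

Lemma rVcons_shiftr n (x t : R) (y : 'rV[R]_n) (i : 'I_n) :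
  (rVcons (x, t *: basis_vec R i + y) =
   t *: basis_vec R (rshift 1 i) + rVcons (x, y))%R.
Proof.
apply/rowP => j; rewrite [RHS]mxE [X in _ = (X + _)%R]mxE.
have [k ->|k ->] := @split_ordP 1 n j.
  by rewrite !rVconsl mxE eq_lrshift andbF mulr0 add0r.
by rewrite !rVconsr !mxE eq_rshift.
Qed.

(** Induction on the dimension by Fubini. If i is the first coordinate, it is integrated first and
    the fundamental theorem of calculus gives 0 on every line; otherwise the first coordinate is
    frozen and the induction hypothesis applies to the slice. *)
Lemma integral_partial n (g : 'rV[R]_n -> R) (i : 'I_n) (M : R) :
  (forall x, derivable g x (basis_vec R i)) ->
  continuous ('D_(basis_vec R i) g)%R ->
  (forall x, (M < `|x|)%R -> g x = 0%R) ->
  (leb R n).-integrable setT (EFin \o 'D_(basis_vec R i) g)%R /\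
  \int[leb R n]_x ('D_(basis_vec R i) g x)%R%:E = 0.
Proof.
elim: n => [|n IH] in g i M *; first by case: i.
move=> dg cg g0.
have Dg0 x : (M < `|x|)%R -> 'D_(basis_vec R i) g x = 0%R.
  exact: derive_support.
have [K gK] := continuous_bounded_support cg Dg0.
have ig : (leb R n.+1).-integrable setT (EFin \o 'D_(basis_vec R i) g)%R.
  apply: (@integrable_bounded_support R _ _ (leb R n.+1) _ _ K
    (@measurable_cball_rV R n.+1 M)).
  - exact: leb_cball_lty.
  - exact: continuous_mx_measurable.
  - exact: gK.
  by move=> x /= /negP; rewrite -ltNge; exact: Dg0.
split => //.
have [ip ->] := leb_rVconsE ig.
have [k ik|k ik] := @split_ordP 1 n i.
- rewrite -integral21_prod_meas1//; apply: integral0_eq => y _.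
  rewrite /fubini_G /=.
  pose h (x : R) := g (rVcons (x, y)).
  have hD (x : R) := derive_shift_congr (f := h) (g := g) (a := x) (v := 1%R)
    (b := rVcons (x, y)) (w := basis_vec R (lshift n (0%R : 'I_1)))
    (fun t => congr1 g (rVcons_shiftl x t y)).
  have i0 : i = lshift n (0%R : 'I_1) by rewrite ik ord1.
  have dh x : derivable h x 1%R by rewrite (hD x).1 -i0.
  have Dh (x : R) : ('D_(basis_vec R i) g (rVcons (x, y)) = derive1 h x)%R.
    by rewrite derive1E (hD x).2 i0.
  have h0 x : (M < `|x|)%R -> h x = 0%R.
    move=> Mx; apply: g0; apply: lt_le_trans Mx _.
    by have [] := rVcons_norm x y.
  (* N is positive and exceeds M, so [-N, N] is a proper interval, h vanishes at both endpoints, and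
     the derivative vanishes outside. *)
  pose N := (Num.max M 0 + 1)%R.
  have N0 : (0 < N)%R by rewrite ltr_wpDl// le_max lexx orbT.
  have MN : (M < N)%R by rewrite ltr_pwDr// le_max lexx.
  have hc : continuous h.
    by move=> x; apply/differentiable_continuous/derivable1_diffP.
  transitivity (\int[lebesgue_measure]_(x in `[(- N)%R, N]) (derive1 h x)%:E).
    rewrite [RHS]integral_mkcond; apply: eq_integral => x _; rewrite patchE.
    case: ifPn => [_|]; first by rewrite Dh.
    rewrite notin_setE /= in_itv /= => /negP; rewrite -ler_norml -ltNge => Nx.
    rewrite Dg0//; apply: lt_trans MN _; apply: lt_le_trans Nx _.
    by have [] := rVcons_norm x y.
  rewrite (@continuous_FTC2 _ _ h).
  + by rewrite !h0 ?subee// ?normrN gtr0_norm.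
  + by rewrite gtrN.
  + apply: continuous_subspaceT => x; rewrite -(funext Dh).
    apply: (@continuous_comp R 'rV[R]_n.+1 R (fun x => rVcons (x, y))
      ('D_(basis_vec R i) g)%R); last exact: cg.
    exact: continuous_rVconsl.
  + split; first by move=> x _; exact: dh.
      by apply: cvg_at_right_filter; exact: hc.
    by apply: cvg_at_left_filter; exact: hc.
  + by [].
- rewrite -integral12_prod_meas1//; apply: integral0_eq => x _.
  rewrite /fubini_F /=.
  pose h (y : 'rV[R]_n) := g (rVcons (x, y)).
  have hD y := derive_shift_congr (f := h) (g := g) (a := y) (v := basis_vec R
    k)
    (b := rVcons (x, y)) (w := basis_vec R (rshift 1 k))
    (fun t => congr1 g (rVcons_shiftr x t y k)).
  have Dh y : ('D_(basis_vec R i) g (rVcons (x, y)) = 'D_(basis_vec R k) h y)%R.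
    by rewrite (hD y).2 ik.
  under eq_integral do rewrite Dh.
  apply: (IH _ _ M _ _ _).2.
  + by move=> y; rewrite (hD y).1 -ik.
  + move=> y; rewrite -(funext Dh).
    apply: (@continuous_comp 'rV[R]_n 'rV[R]_n.+1 R (fun y => rVcons (x, y))
      ('D_(basis_vec R i) g)%R); last exact: cg.
    exact: continuous_rVconsr.
  + move=> y My; apply: g0; apply: lt_le_trans My _.
    by have [] := rVcons_norm x y.
Qed.

End divergence.

(** * Square roots of positive definite matrices *)

Section dot_theory.
Context (R : realType) (d : nat).
Implicit Types (u v w : 'rV[R]_d) (M : 'M[R]_d).

Lemma dotE u v : dot u v = (u *m v^T) 0 0.
Proof. by rewrite mxE; apply: eq_bigr => i _; rewrite mxE. Qed.

Lemma dotC u v : dot u v = dot v u.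
Proof. by apply: eq_bigr => i _; rewrite mulrC. Qed.

Lemma dotDl u v w : dot (u + v) w = dot u w + dot v w.
Proof. by rewrite -big_split; apply: eq_bigr => i _; rewrite mxE mulrDl. Qed.

Lemma dotZl (a : R) u v : dot (a *: u) v = a * dot u v.
Proof. by rewrite /dot mulr_sumr; apply: eq_bigr => i _; rewrite mxE mulrA. Qed.

Lemma dotDr u v w : dot u (v + w) = dot u v + dot u w.
Proof. by rewrite !(dotC u) dotDl. Qed.

Lemma dotZr (a : R) u v : dot u (a *: v) = a * dot u v.
Proof. by rewrite !(dotC u) dotZl. Qed.

Lemma dotNl u v : dot (- u) v = - dot u v.
Proof. by rewrite -scaleN1r dotZl mulN1r. Qed.

Lemma dotNr u v : dot u (- v) = - dot u v.
Proof. by rewrite !(dotC u) dotNl. Qed.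

Lemma dot0r u : dot u 0 = 0.
Proof. by rewrite /dot big1// => i _; rewrite mxE mulr0. Qed.

Lemma dot_ge0 u : 0 <= dot u u.
Proof. by apply: sumr_ge0 => i _; rewrite -expr2 sqr_ge0. Qed.

Lemma dot_eq0 u : (dot u u == 0) = (u == 0).
Proof.
apply/eqP/eqP => [|->]; last by rewrite /dot big1// => i _; rewrite mxE mul0r.
move=> /eqP; rewrite psumr_eq0 => [/allP h|i _]; last by rewrite -expr2 sqr_ge0.
apply/rowP => i; rewrite mxE; apply/eqP.
by have := h i (mem_index_enum _); rewrite /= -expr2 sqrf_eq0.
Qed.

Lemma dot_mulmx u v M : dot (u *m M) v = dot u (v *m M^T).
Proof. by rewrite !dotE trmx_mul trmxK mulmxA. Qed.

End dot_theory.

Section sqrtmx_existence.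
Context (R : realType).

(** Newton's scheme: a new node is corrected by a multiple of the polynomial vanishing at the
    earlier ones. Repeated nodes are allowed, since the nodes will be eigenvalues. *)
Lemma interpolation (s : seq R) (f : R -> R) :
  exists p : {poly R}, forall x, x \in s -> p.[x] = f x.
Proof.
elim: s => [|a s [p pf]]; first by exists 0.
have [as_|as_] := boolP (a \in s).
  by exists p => x; rewrite inE => /predU1P[->|]; exact: pf.
pose q := \prod_(b <- s) ('X - b%:P).
have qa : q.[a] != 0 by rewrite -rootE root_prod_XsubC.
exists (p + ((f a - p.[a]) / q.[a])%:P * q) => x.
rewrite !hornerE inE => /predU1P[->|xs]; first by rewrite divfK// addrC subrK.
have /eqP -> : q.[x] == 0 by rewrite -rootE root_prod_XsubC.
by rewrite mulr0 addr0 pf.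
Qed.

(** This is the reason for seeking the root of M among its polynomials: symmetry comes for free, and
    real coefficients keep the root real. *)
Lemma trmx_horner n (M : 'M[R]_n.+1) (p : {poly R}) :
  M^T = M -> (horner_mx M p)^T = horner_mx M p.
Proof.
move=> sM; elim/poly_ind: p => [|p c IH]; first by rewrite rmorph0 trmx0.
rewrite rmorphD rmorphM /= horner_mx_X horner_mx_C raddfD /= tr_scalar_mx.
congr (_ + _); rewrite -[LHS]/((_ *m _)^T) trmx_mul IH sM.
by apply: comm_mx_horner.
Qed.

(* The eigenvalues are those of the complex spectral theorem; they have real
   eigenvectors since M is real. *)
Lemma psd_spectral n (M : 'M[R]_n.+1) : psd M ->
  exists (P : 'M[R[i]]_n.+1) (l : 'rV[R]_n.+1),
  [/\ P \in unitmx, map_mx (real_complex R) M =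
        invmx P *m diag_mx (map_mx (real_complex R) l) *m P &
      forall i, 0 <= l 0 i].
Proof.
move=> [sM M0]; pose MC := map_mx (real_complex R) M.
have hM : MC \is hermsymmx.
  apply: realsym_hermsym.
    apply/is_hermitianmxP; rewrite expr0 scale1r map_mx_id//.
    by rewrite /MC map_trmx sM.
  by apply/mxOverP => i j; rewrite mxE; apply/complex_realP; exists (M i j).
have /mxOverP rD := hermitian_spectral_diag_real hM.
pose l := map_mx (@complex.Re R) (spectral_diag MC).
have lE : map_mx (real_complex R) l = spectral_diag MC.
  by apply/matrixP => i j; rewrite !mxE RRe_real.
have /hermitian_normalmx /orthomx_spectralP := hM.
set P := spectralmx MC => ME.
have Pu : P \in unitmx by exact: spectral_unit.
exists P, l; split; [exact: Pu|rewrite lE; exact: ME|].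
move=> i; have : eigenvalue MC (real_complex R (l 0 i)).
  apply/eigenvalueP; exists (row i P).
    rewrite -row_mul {1}ME !mulmxA mulmxV// mul1mx row_mul row_diag_mx.
    by rewrite -lE -scalemxAl -rowE mxE.
  apply/eqP => P0; have := row_mul i P (invmx P).
  rewrite P0 mul0mx mulmxV// => /rowP/(_ i); rewrite !mxE eqxx => /eqP.
  by rewrite oner_eq0.
rewrite eigenvalue_map => /eigenvalueP[v vM v0].
have := M0 v; rewrite /mxact sM vM dotZr pmulr_lge0//.
by rewrite lt_neqAle eq_sym dot_eq0 v0 dot_ge0.
Qed.

(** The diagonalisation is complex, but the root is a real polynomial in M that interpolates at the
    eigenvalues. Complex matrices serve only to verify the identity, which becomes diagonal
    there. *)
Lemma sqrtmx_exists n (M : 'M[R]_n) : psd M -> exists S, psd S /\ S *m S = M.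
Proof.
case: n M => [|n] M psdM.
  by exists M; split => //; apply/matrixP => -[].
have [P [l [Pu ME l0]]] := psd_spectral psdM.
have [p pE] := interpolation [seq l 0 i | i <- enum 'I_n.+1]
  (fun x => Num.sqrt (Num.sqrt x)).
(* T is a fourth root of M; its square is positive because T is symmetric. *)
pose T := horner_mx M p.
have sT : T^T = T by apply: trmx_horner; case: psdM.
exists (T *m T); split.
  split=> [|v]; first by rewrite trmx_mul sT.
  by rewrite /mxact trmx_mul sT mulmxA dotC dot_mulmx sT dot_ge0.
have T4 : T *m T *m (T *m T) = horner_mx M (p ^+ 4).
  by rewrite rmorphXn /= -/T !exprS expr0 mulr1 !mulmxE !mulrA.
rewrite T4; apply: (@map_mx_inj _ _ (real_complex R)).
rewrite map_horner_mx ME horner_mx_uconjC// horner_mx_diag.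
congr (_ *m diag_mx _ *m _).
apply/rowP => i; rewrite !mxE.
rewrite horner_map /= horner_exp pE ?map_f ?mem_enum//.
by rewrite -[4%N]/(2 * 2)%N exprM !sqr_sqrtr// sqrtr_ge0.
Qed.

End sqrtmx_existence.

(** * Pointwise bounds for elliptic matrices, and Young's inequality *)

Section energy_bounds.
Context (R : realType) (d : nat).
Implicit Types (u v w y : 'rV[R]_d) (M : 'M[R]_d).

Lemma mxactD M u v : mxact M (u + v) = mxact M u + mxact M v.
Proof. exact: mulmxDl. Qed.

Lemma mxactN M u : mxact M (- u) = - mxact M u.
Proof. exact: mulNmx. Qed.

Lemma mxactM M N u : mxact M (mxact N u) = mxact (M *m N) u.
Proof. by rewrite /mxact trmx_mul mulmxA. Qed.

Lemma dot_mxact M u v : M^T = M -> dot (mxact M u) v = dot u (mxact M v).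
Proof. by move=> sM; rewrite /mxact dot_mulmx trmxK sM. Qed.

(** Expand k^-1 |u - k v|^2 >= 0. The weight k stays free so that it can be optimised after
    integration. *)
Lemma dot_le (k : R) u v : 0 < k ->
  dot u v <= (k * dot v v + k^-1 * dot u u) / 2.
Proof.
move=> k0; have := dot_ge0 (u - k *: v).
rewrite dotDl !dotDr !dotNl !dotNr !dotZl !dotZr (dotC v u) => h.
have : 0 <= k^-1 * (dot u u - 2 * k * dot u v + k ^+ 2 * dot v v).
  by rewrite mulr_ge0 ?invr_ge0 ?(ltW k0)//; lra.
rewrite [leRHS](_ : _ = k^-1 * dot u u - 2 * dot u v + k * dot v v); last first.
  by field; rewrite gt_eqF.
lra.
Qed.

Lemma dot_sum3_le u v w :
  dot (u + v + w) (u + v + w) <= 3 * (dot u u + dot v v + dot w w).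
Proof.
have := dot_ge0 (u - v); have := dot_ge0 (v - w); have := dot_ge0 (u - w).
rewrite !(dotDl, dotDr, dotNl, dotNr) (dotC v u) (dotC w u) (dotC w v).
lra.
Qed.

Section spd.
Variables (M : 'M[R]_d) (a0 a1 : R).
Hypotheses (sM : M^T = M) (a0_gt0 : 0 < a0)
  (M_bounds : forall u, a0 * dot u u <= dot u (mxact M u) <= a1 * dot u u).

Lemma spd_psd : psd M.
Proof.
split=> // v; have /andP[+ _] := M_bounds v; apply: le_trans.
by rewrite mulr_ge0 ?dot_ge0// ltW.
Qed.

Lemma sqrtmxP : psd (sqrtmx M) /\ sqrtmx M *m sqrtmx M = M.
Proof. exact: (xgetPex 0 (sqrtmx_exists spd_psd)). Qed.

Lemma sqrtmx_sym : (sqrtmx M)^T = sqrtmx M.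
Proof. by have [[]] := sqrtmxP. Qed.

Lemma sqrtmx_unit : sqrtmx M \in unitmx.
Proof.
rewrite -row_free_unit; apply: inj_row_free => v vS.
have /andP[+ _] := M_bounds v.
rewrite /mxact sM -{1}sqrtmxP.2 mulmxA vS mul0mx.
rewrite dot0r pmulr_rle0// => h.
by apply/eqP; rewrite -dot_eq0 eq_le h dot_ge0.
Qed.

(** Brings the gradient term of the estimator under the same A^(-1/2) as the other three terms. *)
Lemma mxact_sqrtmxV u : mxact (sqrtmx M) u = mxact (sqrtmxV M) (mxact M u).
Proof.
by rewrite mxactM -{3}sqrtmxP.2 mulmxA mulVmx ?sqrtmx_unit// mul1mx.
Qed.

(** Since y = M^(1/2) t, the square |y|^2 equals t . M t, to which ellipticity applies. *)
Lemma sqrtmxV_bounds y (t := mxact (sqrtmxV M) y) :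
  a0 * dot t t <= dot y y <= a1 * dot t t.
Proof.
suff -> : dot y y = dot t (mxact M t) by exact: M_bounds.
rewrite -sqrtmxP.2 -mxactM -(dot_mxact _ _ sqrtmx_sym).
by rewrite /t mxactM mulmxV ?sqrtmx_unit// /mxact trmx1 mulmx1.
Qed.

Lemma dot_mxact_le u : dot (mxact M u) (mxact M u) <= a1 ^+ 2 * dot u u.
Proof.
(* Only a nonzero vector reveals the sign of a1, hence the separate case u = 0 below. Otherwise,
   with S the root of M, |M u|^2 = S u . M (S u) <= a1 |S u|^2 = a1 (u . M u). *)
have a1_ge0 (v : 'rV[R]_d) : v != 0 -> 0 <= a1.
  rewrite -dot_eq0 => v0; have v1 : 0 < dot v v by rewrite lt_def v0 dot_ge0.
  rewrite -(pmulr_lge0 _ v1).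
  have /andP[h1 h2] := M_bounds v; apply: le_trans h2; apply: le_trans h1.
  by rewrite mulr_ge0 ?dot_ge0// ltW.
have [->|u0] := eqVneq u 0.
  by rewrite /mxact mul0mx !dot0r mulr0.
have {}a1_ge0 := a1_ge0 _ u0.
rewrite -{1 2}sqrtmxP.2 -!mxactM (dot_mxact _ _ sqrtmx_sym) mxactM sqrtmxP.2.
have /andP[_ h] := M_bounds (mxact (sqrtmx M) u).
apply: le_trans h _; rewrite expr2 -mulrA ler_wpM2l//.
rewrite (dot_mxact _ _ sqrtmx_sym) mxactM sqrtmxP.2.
by have /andP[] := M_bounds u.
Qed.

End spd.

(** Minimising over k turns Young's inequalities into Cauchy-Schwarz. Used on integrated quantities,
    it handles the vector and scalar parts of an H^1 pairing together. *)
Lemma sqrt_mul_ge (x P Q : R) : 0 <= P -> 0 <= Q ->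
  (forall k, 0 < k -> x <= (k * P + k^-1 * Q) / 2) ->
  x <= Num.sqrt P * Num.sqrt Q.
Proof.
move=> P0 Q0 xk.
have [Peq0|Pn0] := eqVneq P 0.
  rewrite Peq0 sqrtr0 mul0r leNgt; apply/negP => x0.
  (* For P = 0 the infimum is approached as k grows; this k is large enough to give x <= x Q / (2 (Q
     + 1)) < x. The case Q = 0 is symmetric, with a small k. *)
  have k0 : 0 < (Q + 1) / x by rewrite divr_gt0// ltr_wpDl.
  have := xk _ k0; rewrite Peq0 mulr0 add0r invf_div.
  rewrite leNgt => /negP; apply.
  rewrite ltr_pdivrMr// mulrAC ltr_pdivrMr ?ltr_wpDl//; nra.
have [Qeq0|Qn0] := eqVneq Q 0.
  rewrite Qeq0 sqrtr0 mulr0 leNgt; apply/negP => x0.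
  have k0 : 0 < x / (P + 1) by rewrite divr_gt0// ltr_wpDl.
  have := xk _ k0; rewrite Qeq0 mulr0 addr0.
  rewrite leNgt => /negP; apply.
  rewrite ltr_pdivrMr// mulrAC ltr_pdivrMr ?ltr_wpDl//; nra.
have p0 : 0 < Num.sqrt P by rewrite sqrtr_gt0 lt_def Pn0.
have q0 : 0 < Num.sqrt Q by rewrite sqrtr_gt0 lt_def Qn0.
(* The minimiser k = sqrt Q / sqrt P makes the two summands equal. *)
have := xk _ (divr_gt0 q0 p0).
rewrite -{2}(sqr_sqrtr P0) -{3}(sqr_sqrtr Q0).
by congr (_ <= _); field; rewrite !gt_eqF.
Qed.

End energy_bounds.

(** * Square-integrable functions *)

Section L2_theory.
Import HBNNSimple.
Context (R : realType) (d : nat) (mu : {measure set 'rV[R]_d -> \bar R}).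
Context (D : set 'rV[R]_d) (mD : measurable D).
Implicit Types f g : 'rV[R]_d -> R.

Local Notation integrable f := (mu.-integrable D (fun x => (f x)%:E)).
Local Notation Int f := (\int[mu]_(x in D) (f x))%R.

(* The integral of a nonnegative function is a supremum over simple functions
   below it, and these may be cut off on a null set.  The estimator needs this
   for integrands that are not known to be measurable, since [sqrtmx] is junk
   wherever A is not positive definite. *)
Lemma le_integral_ae f g :
  (forall x, 0 <= f x) -> (forall x, 0 <= g x) ->
  (\forall x \ae mu, D x -> f x <= g x) ->
  (\int[mu]_(x in D) (f x)%:E <= \int[mu]_(x in D) (g x)%:E)%E.
Proof.
move=> f0 g0 [N [mN N0 fgN]].
rewrite integral_mkcond [leRHS]integral_mkcond.
rewrite ge0_integralTE; last by move=> x; rewrite patchE; case: ifP => //;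
  rewrite lee_fin.
apply: ge_ereal_sup => _ [h /= hf <-].
rewrite -integralT_nnsfun (ge0_negligible_integral mN)//; last 2 first.
- by apply/measurable_EFinP.
- by move=> x _; rewrite lee_fin.
rewrite setTD integral_mkcond.
rewrite ge0_integralTE; last by move=> x; rewrite patchE; case: ifP => //;
  rewrite lee_fin.
rewrite ge0_integralTE; last by move=> x; rewrite patchE; case: ifP => //;
  rewrite lee_fin.
apply: ereal_sup_le => _ [k kh <-].
exists k => // x; apply: le_trans (kh x) _.
rewrite !patchE in_setC; case: ifPn => [|_]; last first.
  by case: ifP => // _; rewrite lee_fin.
rewrite notin_setE => xN; apply: le_trans (hf x) _; rewrite patchE.
case: ifPn => //; rewrite inE => xD; rewrite lee_fin.
apply: contrapT => fg; apply: xN; apply: fgN => /= fgx.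
by apply: fg; exact: fgx.
Qed.

Lemma integrable_L2M f g : L2 mu D f -> L2 mu D g ->
  integrable (fun x => f x * g x).
Proof.
move=> [mf fi] [mg gi].
have sq (h : 'rV[R]_d -> R) : measurable_fun D h -> (\int[mu]_(x in D) ((h x)
  ^+ 2)%:E < +oo)%E ->
    mu.-integrable D (fun x => ((h x) ^+ 2)%:E).
  move=> mh hi; apply/integrableP; split.
    by apply/measurable_EFinP; exact: measurable_funX.
  under eq_integral do rewrite gee0_abs ?lee_fin ?sqr_ge0//.
  exact: hi.
apply: (@le_integrable _ _ _ mu D mD _
  (fun x => ((f x) ^+ 2)%:E + ((g x) ^+ 2)%:E)%E).
- by apply/measurable_EFinP; exact: measurable_funM.
- move=> x _; rewrite /= lee_fin [leRHS]ger0_norm ?addr_ge0 ?sqr_ge0//.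
  rewrite ler_norml; apply/andP; split.
    have := sqr_ge0 (f x + g x); have := sqr_ge0 (f x); have := sqr_ge0 (g x);
      nra.
  have := sqr_ge0 (f x - g x); have := sqr_ge0 (f x); have := sqr_ge0 (g x);
    nra.
- by apply: integrableD => //; exact: sq.
Qed.

Lemma L2P f : measurable_fun D f -> L2 mu D f <-> integrable (fun x => f x * f
  x).
Proof.
move=> mf; split=> [f2|/integrableP[_ fi]]; first exact: integrable_L2M.
split => //; apply: le_lt_trans fi.
by rewrite le_eqVlt; apply/orP; left; apply/eqP; apply: eq_integral => x _;
  rewrite gee0_abs ?expr2// lee_fin -expr2 sqr_ge0.
Qed.

Lemma L2_le f g : measurable_fun D f -> L2 mu D g -> 
  (\forall x \ae mu, D x -> f x ^+ 2 <= g x ^+ 2) -> L2 mu D f.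
Proof.
move=> mf [mg gi] fg; split => //; apply: le_lt_trans gi.
by apply: le_integral_ae => // x; exact: sqr_ge0.
Qed.

Lemma L2_cst0 : L2 mu D (fun=> 0).
Proof.
split; first exact: measurable_cst.
by rewrite integral0_eq// => x _; rewrite expr0n.
Qed.

Lemma L2D f g : L2 mu D f -> L2 mu D g -> L2 mu D (fun x => f x + g x).
Proof.
move=> f2 g2; have [mf _] := f2; have [mg _] := g2.
apply/L2P; first exact: measurable_funD.
apply: (eq_integrable mD (fun x => (f x * f x)%:E + ((f x * g x)%:E +
  ((f x * g x)%:E + (g x * g x)%:E)))%E).
  by move=> x _; rewrite -!EFinD; congr EFin; ring.
by do !(apply: integrableD => //); exact: integrable_L2M.
Qed.

Lemma L2Z (k : R) f : L2 mu D f -> L2 mu D (fun x => k * f x).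
Proof.
move=> f2; have [mf _] := f2; apply/L2P.
  by apply: measurable_funM => //; exact: measurable_cst.
apply: (eq_integrable mD (fun x => (k * k)%:E * (f x * f x)%:E)%E).
  by move=> x _; rewrite -!EFinM; congr EFin; ring.
by apply: integrableZl => //; exact: integrable_L2M.
Qed.

Lemma L2N f : L2 mu D f -> L2 mu D (fun x => - f x).
Proof.
move=> /(L2Z (-1)); congr (L2 _ _ _).
by apply/funext => x; rewrite mulN1r.
Qed.

Lemma L2B f g : L2 mu D f -> L2 mu D g -> L2 mu D (fun x => f x - g x).
Proof. by move=> f2 g2; apply: L2D => //; exact: L2N. Qed.

Lemma L2_sum n (F : 'I_n -> 'rV[R]_d -> R) : (forall i, L2 mu D (F i)) ->
  L2 mu D (fun x => \sum_(i < n) F i x).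
Proof.
elim: n => [|n IH] in F * => F2.
  under eq_fun do rewrite big_ord0.
  exact: L2_cst0.
under eq_fun do rewrite big_ord_recr/=.
by apply: L2D => //; apply: IH.
Qed.

Lemma LinfM f g : Linf mu D f -> L2 mu D g -> L2 mu D (fun x => f x * g x).
Proof.
move=> [mf [M fM]] g2; have [mg _] := g2.
apply: (L2_le _ (L2Z M g2)); first exact: measurable_funM.
apply: filterS fM => x fM Dx; rewrite !exprMn ler_wpM2r ?sqr_ge0//.
rewrite -real_normK ?num_real// lerXn2r ?nnegrE//; last exact: fM.
exact: le_trans (fM Dx).
Qed.

Lemma le_Int f g : integrable f -> integrable g ->
  (\forall x \ae mu, D x -> f x <= g x) -> Int f <= Int g.
Proof.
move=> fi gi fg; rewrite -subr_ge0 -RintegralB//.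
(* g - f is nonnegative only almost everywhere; its absolute value is nonnegative at every point and
   has the same integral. *)
rewrite [leRHS](_ : _ = Int (fun x => `|g x - f x|)).
  by apply: Rintegral_ge0.
have mh : measurable_fun D (fun x => g x - f x).
  have /measurable_EFinP mf := measurable_int _ fi.
  have /measurable_EFinP mg := measurable_int _ gi.
  exact: measurable_funB.
congr fine; apply: ae_eq_integral => //.
- exact/measurable_EFinP.
- by apply/measurable_EFinP; apply: measurableT_comp.
- apply: filterS fg => x fg Dx; congr EFin.
  by rewrite ger0_norm// subr_ge0; exact: fg.
Qed.

Lemma eq_Int f g : integrable f -> integrable g ->
  (\forall x \ae mu, D x -> f x = g x) -> Int f = Int g.
Proof.
by move=> fi gi fg; apply/eqP; rewrite eq_le; apply/andP; split;
  apply: le_Int => //; apply: filterS fg => x fg Dx; rewrite fg.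
Qed.

End L2_theory.

(** * Square-integrable fields and test functions on an open set *)

Section domain.
Context (R : realType) (d : nat) (Om : set 'rV[R]_d) (oOm : open Om).
Notation E := 'rV[R]_d.
Implicit Types (f g : E -> R) (F G : E -> E).

Local Notation mu := (leb R d).
Local Notation integrable f := (mu.-integrable Om (fun x => (f x)%:E)).
Local Notation Int f := (\int[mu]_(x in Om) (f x))%R.

Lemma measurable_domain : measurable Om.
Proof. exact: mx_open_measurable. Qed.

Let mOm := measurable_domain.

Lemma integrable_dot F G : L2vec Om F -> L2vec Om G ->
  integrable (fun x => dot (F x) (G x)).
Proof.
move=> F2 G2; rewrite /dot.
under eq_fun do rewrite -sumEFin.
by apply: integrable_sum => // i _; exact: (integrable_L2M mOm).
Qed.

Lemma L2vecD F G : L2vec Om F -> L2vec Om G -> L2vec Om (fun x => F x + G x).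
Proof.
move=> F2 G2 i; under eq_fun do rewrite mxE.
exact: (L2D mOm).
Qed.

Lemma L2vecN F : L2vec Om F -> L2vec Om (fun x => - F x).
Proof.
move=> F2 i; under eq_fun do rewrite mxE.
exact: (L2N mOm).
Qed.

Lemma L2vecB F G : L2vec Om F -> L2vec Om G -> L2vec Om (fun x => F x - G x).
Proof. by move=> F2 G2; apply: L2vecD => //; exact: L2vecN. Qed.

Lemma L2vec_mxact (A : E -> 'M[R]_d) F :
  (forall i j, Linf mu Om (fun x => A x i j)) -> L2vec Om F ->
  L2vec Om (fun x => mxact (A x) (F x)).
Proof.
move=> Ai F2 i; rewrite /mxact; under eq_fun do rewrite mxE.
apply: (L2_sum mOm) => j; under eq_fun do rewrite mxE mulrC.
exact: (LinfM mOm).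
Qed.

Lemma L2vec_scale (b : E -> E) f :
  (forall i, Linf mu Om (fun x => b x 0 i)) -> L2 mu Om f ->
  L2vec Om (fun x => f x *: b x).
Proof.
move=> bi f2 i; under eq_fun do rewrite mxE mulrC.
exact: (LinfM mOm).
Qed.

Lemma L2_dot_Linf (b : E -> E) F :
  (forall i, Linf mu Om (fun x => b x 0 i)) -> L2vec Om F ->
  L2 mu Om (fun x => dot (b x) (F x)).
Proof. by move=> bi F2; apply: (L2_sum mOm) => i; exact: (LinfM mOm). Qed.

Lemma Linf_vec_bound (b : E -> E) :
  (forall i, Linf mu Om (fun x => b x 0 i)) ->
  exists B : R, 0 <= B /\ \forall x \ae mu, Om x -> dot (b x) (b x) <= B.
Proof.
move=> bi.
pose M i := projT1 (cid (bi i).2).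
have MP i : \forall x \ae mu, Om x -> `|b x 0 i| <= M i := projT2 (cid (bi
  i).2).
exists (\sum_i M i ^+ 2); split; first by apply: sumr_ge0 => i _;
  exact: sqr_ge0.
have : \forall x \ae mu, forall i, Om x -> `|b x 0 i| <= M i.
  exact: filter_forall.
apply: filterS => x h Ox; apply: ler_sum => i _.
rewrite -expr2 -real_normK ?num_real// lerXn2r ?nnegrE//; last exact: h.
exact: le_trans (h i Ox).
Qed.

Lemma Linf_bound f : Linf mu Om f ->
  exists C : R, 0 <= C /\ \forall x \ae mu, Om x -> f x ^+ 2 <= C.
Proof.
move=> [_ [M fM]]; exists (M ^+ 2); split; first exact: sqr_ge0.
apply: filterS fM => x h Ox.
rewrite -real_normK ?num_real// lerXn2r ?nnegrE//; last exact: h.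
exact: le_trans (h Ox).
Qed.

Lemma test_fun_support phi : test_fun Om phi ->
  (exists M : R, forall x, M < `|x| -> phi x = 0) /\
  (forall x, ~ Om x -> phi x = 0).
Proof.
move=> [_ [K [cK KO phi0]]]; split; last first.
  by move=> x Ox; apply: phi0 => /KO.
have [M [_ MK]] := compact_bounded cK.
exists (M + 1) => x Mx; apply: phi0 => Kx.
have := MK (M + 1); rewrite ltrDl ltr01 => /(_ isT _ Kx) /=.
by rewrite leNgt Mx.
Qed.

(** x may lie on the boundary of Om, so phi = 0 outside Om would not suffice: the complement of the
    compact support set K is a neighbourhood of x on which phi vanishes. *)
Lemma test_fun_derive phi i x : test_fun Om phi ->
  ~ Om x -> 'D_(basis_vec R i) phi x = 0.
Proof.
move=> [_ [K [cK KO phi0]]] Ox.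
have nK : \forall y \near x, phi y = 0.
  have : open (~` K) by apply: closed_openC; exact: compact_closed.
  rewrite openE => /(_ x) /=; rewrite /interior.
  have nKx : (~` K) x by move=> /KO.
  by move=> /(_ nKx); apply: filterS => y; exact: phi0.
by rewrite (near_eq_derive (g := cst 0))// derive_cst.
Qed.

Lemma test_fun_continuous phi : test_fun Om phi -> continuous phi.
Proof. by move=> [/(_ 0%N)]. Qed.

Lemma test_fun_derivable phi i x : test_fun Om phi ->
  derivable phi x (basis_vec R i).
Proof. by move=> [/(_ 1%N) [_ /(_ i) []]]. Qed.

Lemma test_fun_derive_continuous phi i : test_fun Om phi ->
  continuous ('D_(basis_vec R i) phi).
Proof. by move=> [/(_ 1%N) [_ /(_ i) []]]. Qed.

Lemma continuous_support_L2 f (M : R) : continuous f ->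
  (forall x, M < `|x| -> f x = 0) -> L2 mu Om f.
Proof.
move=> cf f0; have [K fK] := continuous_bounded_support cf f0.
have mf := continuous_mx_measurable cf.
have mfO : measurable_fun Om f by exact: measurable_funTS.
apply/(L2P (leb R d) mOm mfO).
apply: (@integrableS _ _ _ mu setT) => //.
apply: (@integrable_bounded_support R _ _ mu _ (fun x => f x * f x) (K * K)
  (@measurable_cball_rV R d M)).
- exact: leb_cball_lty.
- exact: measurable_funM.
- by move=> x; rewrite normrM ler_pM.
- by move=> x /= /negP; rewrite -ltNge => /f0 ->; rewrite mul0r.
Qed.

Lemma test_fun_L2 phi : test_fun Om phi -> L2 mu Om phi.
Proof.
move=> tphi; have [[M phi0] _] := test_fun_support tphi.
by apply: continuous_support_L2 phi0; exact: test_fun_continuous.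
Qed.

Lemma test_fun_derive_L2 phi i : test_fun Om phi ->
  L2 mu Om ('D_(basis_vec R i) phi).
Proof.
move=> tphi; have [[M phi0] _] := test_fun_support tphi.
apply: (@continuous_support_L2 _ M); first exact: test_fun_derive_continuous.
by move=> x; exact: derive_support.
Qed.

Lemma test_fun_grad_L2 phi : test_fun Om phi -> L2vec Om (grad phi).
Proof.
move=> tphi i; rewrite /grad; under eq_fun do rewrite mxE.
exact: test_fun_derive_L2.
Qed.

(** [integral_partial] for the product phi psi. Its derivative vanishes outside Om, so the integrals
    over Om and over the whole space agree. *)
Lemma test_fun_by_parts phi psi i : test_fun Om phi -> test_fun Om psi ->
  ip Om phi ('D_(basis_vec R i) psi) = - ip Om ('D_(basis_vec R i) phi) psi.
Proof.
move=> tphi tpsi; apply/eqP; rewrite -addr_eq0 -RintegralD//; last 2 first.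
- by apply: (integrable_L2M mOm); [exact: test_fun_L2|exact:
  test_fun_derive_L2].
- by apply: (integrable_L2M mOm); [exact: test_fun_derive_L2|exact:
  test_fun_L2].
have [[M phi0] phiO] := test_fun_support tphi.
pose e := basis_vec R i; pose g : E -> R := phi * psi.
have dg x : derivable g x e by apply: derivableM; exact: test_fun_derivable.
have Dg x : 'D_e g x = phi x * 'D_e psi x + 'D_e phi x * psi x.
  rewrite deriveM; [|exact: test_fun_derivable..].
  by congr (_ + _); rewrite mulrC.
have cM (f h : E -> R) : continuous f -> continuous h -> continuous (f \* h).
  by move=> cf ch x; apply: continuousM; [exact: cf|exact: ch].
have c1 := cM _ _ (test_fun_continuous tphi) (test_fun_derive_continuous (i :=
  i) tpsi).
have c2 := cM _ _ (test_fun_derive_continuous (i := i) tphi)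
  (test_fun_continuous tpsi).
have cDg : continuous ('D_e g).
  by rewrite (funext Dg) => x; exact: (cvgD (c1 x) (c2 x)).
have g0 x : M < `|x| -> g x = 0 
  by move=> /phi0 px; rewrite -[LHS]/(phi x * psi x) px mul0r.
have [_ Ig] := integral_partial dg cDg g0.
apply/eqP; rewrite -[RHS]/(fine (0 : \bar R)) -Ig Rintegral_mkcond.
congr fine; apply: eq_integral => x _; congr EFin; rewrite patchE Dg.
case: ifPn => //; rewrite notin_setE => xO.
by rewrite phiO// (test_fun_derive _ tphi)// !mul0r addr0.
Qed.

End domain.

(** * Traces *)

Section traces.
Context (R : realType) (d : nat).
Notation E := 'rV[R]_d.
Implicit Types (Om : set E) (f g u : E -> R).

(** Passes to the limit in (a - b)^2 <= 2 a^2 + 2 b^2, for each of the three limits defining a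
    trace. The doubles are written as sums so that additivity of the integral suffices. *)
Lemma cvg_integral_sq_le (mu : {measure set E -> \bar R}) (D : set E)
    (F G H : nat -> E -> R) : measurable D ->
  (forall n, measurable_fun D (G n)) -> (forall n, measurable_fun D (H n)) ->
  (forall n x, 0 <= F n x) -> (forall n x, 0 <= G n x) ->
  (forall n x, 0 <= H n x) ->
  (forall n x, F n x <= (G n x + G n x) + (H n x + H n x)) ->
  (\int[mu]_(x in D) (G n x)%:E)%E @[n --> \oo] --> 0%E ->
  (\int[mu]_(x in D) (H n x)%:E)%E @[n --> \oo] --> 0%E ->
  (\int[mu]_(x in D) (F n x)%:E)%E @[n --> \oo] --> 0%E.
Proof.
move=> mD mG mH F0 G0 H0 FGH cG cH.
pose iG n := (\int[mu]_(x in D) (G n x)%:E)%E.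
pose iH n := (\int[mu]_(x in D) (H n x)%:E)%E.
have c0 : ((iG \+ iG) \+ (iH \+ iH))%E @ \oo --> (0 + 0 + (0 + 0))%E.
  by apply: cvgeD; rewrite ?adde0//; rewrite -[X in _ --> X]adde0; apply: cvgeD.
rewrite !adde0 in c0.
apply: squeeze_cvge (cvg_cst 0%E) c0.
apply: nearW => n; apply/andP; split.
  by apply: integral_ge0 => x _; rewrite lee_fin.
have mGE : measurable_fun D (fun x => (G n x)%:E) by exact/measurable_EFinP.
have mHE : measurable_fun D (fun x => (H n x)%:E) by exact/measurable_EFinP.
have D2 (K : E -> R) : measurable_fun D (fun x => (K x)%:E) ->
    (forall x, 0 <= K x) -> (\int[mu]_(x in D) (K x + K x)%:E =
    \int[mu]_(x in D) (K x)%:E + \int[mu]_(x in D) (K x)%:E)%E.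
  move=> mK K0; under eq_integral do rewrite EFinD.
  by rewrite ge0_integralD// => x _; rewrite lee_fin.
have := le_integral_ae (mu := mu) (D := D) (F0 n)
  (g := fun x => (G n x + G n x) + (H n x + H n x)).
have FG : \forall x \ae mu, D x -> F n x <= (G n x + G n x) + (H n x + H n x).
  by apply: aeW => x _; exact: FGH.
move=> /(_ _ FG) h; apply: le_trans (h _) _.
  by move=> x; rewrite !addr_ge0.
under eq_integral do rewrite EFinD.
rewrite ge0_integralD//; last 4 first.
- by move=> x _; rewrite lee_fin addr_ge0.
- by apply/measurable_EFinP; apply: measurable_funD; exact/measurable_EFinP.
- by move=> x _; rewrite lee_fin addr_ge0.
- by apply/measurable_EFinP; apply: measurable_funD; exact/measurable_EFinP.
by rewrite !D2.
Qed.

Lemma bdry_openC Om x : open Om -> bdry Om x -> ~ Om x.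
Proof. by move=> /interior_id oO [_]; rewrite oO. Qed.

Lemma measurable_bdry Om : measurable (bdry Om).
Proof.
apply: measurableD.
  rewrite -[X in measurable X]setCK; apply: measurableC.
  by apply: mx_open_measurable; apply: closed_openC; exact: closed_closure.
by apply: mx_open_measurable; exact: open_interior.
Qed.

Lemma CkB k f g : Ck k f -> Ck k g -> Ck k (fun x => f x - g x).
Proof.
elim: k f g => [|k IH] f g /=.
  by move=> cf cg x; exact: (cvgB (cf x) (cg x)).
move=> [cf df] [cg dg]; split; first by move=> x; exact: (cvgB (cf x) (cg x)).
move=> i; have [df1 df2] := df i; have [dg1 dg2] := dg i; split.
  by move=> x; exact: (derivableB (df1 x) (dg1 x)).
have := IH _ _ df2 dg2; congr (Ck _ _); apply/funext => x.
by rewrite -[LHS](deriveB (df1 x) (dg1 x)).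
Qed.

Lemma smoothB f g : smooth f -> smooth g -> smooth (fun x => f x - g x).
Proof. by move=> sf sg k; exact: CkB. Qed.

Lemma smooth_measurable f : smooth f -> measurable_fun setT f.
Proof. by move=> /(_ 0%N) cf; exact: continuous_mx_measurable. Qed.

Lemma smooth_derivable f i x : smooth f -> derivable f x (basis_vec R i).
Proof. by move=> /(_ 1%N) [_ /(_ i) []]. Qed.

Lemma smooth_derive_measurable f i : smooth f ->
  measurable_fun setT ('D_(basis_vec R i) f).
Proof.
by move=> /(_ 1%N) [_ /(_ i) [_ cf]]; exact: continuous_mx_measurable.
Qed.

Lemma gradB f g x : smooth f -> smooth g ->
  grad (fun x => f x - g x) x = grad f x - grad g x.
Proof.
move=> sf sg; apply/rowP => i; rewrite !mxE.
exact: deriveB (smooth_derivable sf) (smooth_derivable sg).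
Qed.

Lemma enorm_sqr (v : E) : enorm v ^+ 2 = dot v v.
Proof. by rewrite /enorm sqr_sqrtr ?dot_ge0. Qed.

Lemma measurable_dot_sqr (D : set E) (F : E -> E) : measurable D ->
  (forall i, measurable_fun D (fun x => F x 0 i)) ->
  measurable_fun D (fun x => dot (F x) (F x)).
Proof.
by move=> mD mF; apply: measurable_sum => // i; exact: measurable_funM.
Qed.

(** The differences of the two approximating sequences approximate w. *)
Lemma is_trace_sub Om (z v w : H1 Om) (tz tv : E -> R) : open Om ->
  (forall x, w x = z x - v x) ->
  (forall x, h1_grad w x = h1_grad z x - h1_grad v x) ->
  is_trace z tz -> is_trace v tv -> is_trace w (fun x => tz x - tv x).
Proof.
move=> oO wE gwE [tz2 [uz [suz cz cgz ctz]]] [tv2 [uv [suv cv cgv ctv]]].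
have mO := measurable_domain oO.
have mB := @measurable_bdry Om.
have sqB (a b a' b' : R) : ((a - b) - (a' - b')) ^+ 2 <=
    ((a - a') ^+ 2 + (a - a') ^+ 2) + ((b - b') ^+ 2 + (b - b') ^+ 2).
  by have := sqr_ge0 ((a - a') + (b - b')); nra.
split; first exact: (L2B mB tz2 tv2).
exists (fun n x => uz n x - uv n x); split.
- by move=> n; exact: smoothB.
- apply: cvg_integral_sq_le cz cv => //.
  + move=> n; apply: measurable_funX; apply: measurable_funB.
      exact: measurable_funTS (smooth_measurable (suz n)).
    by have [] := h1_fun_L2 z.
  + move=> n; apply: measurable_funX; apply: measurable_funB.
      exact: measurable_funTS (smooth_measurable (suv n)).
    by have [] := h1_fun_L2 v.
  + by move=> n x; exact: sqr_ge0.
  + by move=> n x; exact: sqr_ge0.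
  + by move=> n x; exact: sqr_ge0.
  + by move=> n x; rewrite wE; exact: sqB.
- have mg (u : nat -> E -> R) (y : H1 Om) n : smooth (u n) ->
      measurable_fun Om (fun x => enorm (grad (u n) x - h1_grad y x) ^+ 2).
    move=> su; under eq_fun do rewrite enorm_sqr.
    apply: measurable_dot_sqr => // i; under eq_fun do rewrite mxE [X in _ +
      X]mxE.
    apply: measurable_funB.
      rewrite /grad; under eq_fun do rewrite mxE.
      by apply: measurable_funTS; exact: smooth_derive_measurable.
    apply: (eq_measurable_fun (fun x => h1_grad y x 0 i)) => //.
    by have [] := h1_grad_L2 y i.
  apply: cvg_integral_sq_le cgz cgv => //.
  + by move=> n; exact: mg.
  + by move=> n; exact: mg.
  + by move=> n x; exact: sqr_ge0.
  + by move=> n x; exact: sqr_ge0.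
  + by move=> n x; exact: sqr_ge0.
  + move=> n x; rewrite gwE gradB// !enorm_sqr.
    (* |a + b|^2 >= 0 is equivalent to |a - b|^2 <= 2 |a|^2 + 2 |b|^2. *)
    have := dot_ge0 ((grad (uz n) x - h1_grad z x) + (grad (uv n) x - h1_grad
      v x)).
    rewrite [X in dot X X <= _](_ : _ = (grad (uz n) x - h1_grad z x) -
      (grad (uv n) x - h1_grad v x)); last first.
      by rewrite !opprB addrACA [RHS]addrACA; congr (_ + _); rewrite addrC.
    move: (_ - h1_grad z x) (_ - h1_grad v x) => a b.
    rewrite !(dotDl, dotDr, dotNl, dotNr) (dotC b a).
    by lra.
- apply: cvg_integral_sq_le ctz ctv => //.
  + move=> n; apply: measurable_funX; apply: measurable_funB.
      exact: measurable_funTS (smooth_measurable (suz n)).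
    by have [] := tz2.
  + move=> n; apply: measurable_funX; apply: measurable_funB.
      exact: measurable_funTS (smooth_measurable (suv n)).
    by have [] := tv2.
  + by move=> n x; exact: sqr_ge0.
  + by move=> n x; exact: sqr_ge0.
  + by move=> n x; exact: sqr_ge0.
Qed.

Lemma eq_on_sub Om (z v w : H1 Om) (phi : E -> R) (Gam : set E) : open Om ->
  (forall x, w x = z x - v x) ->
  (forall x, h1_grad w x = h1_grad z x - h1_grad v x) ->
  eq_on z phi Gam -> eq_on v phi Gam -> eq_on w (fun=> 0) Gam.
Proof.
move=> oO wE gwE [tz [ztz tzE]] [tv [vtv tvE]].
exists (fun x => tz x - tv x); split; first exact: is_trace_sub ztz vtv.
by apply: filterS2 tzE tvE => x h1 h2 Gx; rewrite h1// h2// subrr.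
Qed.

Lemma H1_sub Om (z v : H1 Om) : open Om ->
  exists w : H1 Om, (forall x, w x = z x - v x) /\
    forall x, h1_grad w x = h1_grad z x - h1_grad v x.
Proof.
move=> oO; have mO := measurable_domain oO.
have w2 : L2 (leb R d) Om (fun x => z x - v x).
  exact: (L2B mO (h1_fun_L2 z) (h1_fun_L2 v)).
have g2 : L2vec Om (fun x => h1_grad z x - h1_grad v x).
  exact: (L2vecB oO (@h1_grad_L2 _ _ _ z) (@h1_grad_L2 _ _ _ v)).
have wg : is_weak_grad Om (fun x => z x - v x)
    (fun x => h1_grad z x - h1_grad v x).
  move=> phi tphi i.
  have ipB (f g h : E -> R) : L2 (leb R d) Om f -> L2 (leb R d) Om g ->
      L2 (leb R d) Om h -> ip Om (fun x => f x - g x) h = ip Om f h - ip Om g h.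
    move=> f2 g2' h2; rewrite -RintegralB//; last 2 first.
    - exact: (integrable_L2M mO).
    - exact: (integrable_L2M mO).
    by apply: eq_Rintegral => x _; rewrite mulrBl.
  rewrite ipB; last 3 first.
  - exact: h1_fun_L2.
  - exact: h1_fun_L2.
  - exact: test_fun_derive_L2.
  rewrite (h1_gradP z tphi) (h1_gradP v tphi) -opprD; congr (- _).
  under [in RHS]eq_fun do rewrite mxE [X in _ + X]mxE.
  rewrite ipB//; last 3 first.
  - exact: h1_grad_L2.
  - exact: h1_grad_L2.
  - exact: test_fun_L2.
by exists (MkH1 w2 g2 wg).
Qed.

(** The constant sequence phi witnesses the zero trace, because the boundary of an open set misses
    it. Hence test functions are admissible in the adjoint equation for any [GD]. *)
Lemma test_fun_H1 Om phi : open Om -> test_fun Om phi ->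
  exists w : H1 Om, [/\ forall x, w x = phi x,
    forall x, h1_grad w x = grad phi x & is_trace w (fun=> 0)].
Proof.
move=> oO tphi.
have wg : is_weak_grad Om phi (grad phi).
  move=> psi tpsi i; rewrite test_fun_by_parts//; congr (- _).
  by apply: eq_Rintegral => x _; rewrite mxE.
pose w := MkH1 (test_fun_L2 oO tphi) (test_fun_grad_L2 oO tphi) wg.
have [_ phi0] := test_fun_support tphi.
exists w; split => //; split; first exact: L2_cst0.
exists (fun=> phi); split.
- by move=> _; have [] := tphi.
- apply: cvg_near_cst; apply: nearW => n; apply: integral0_eq => x _.
  by rewrite subrr expr0n.
- apply: cvg_near_cst; apply: nearW => n; apply: integral0_eq => x _.
  by rewrite subrr enorm_sqr dot0r.
- apply: cvg_near_cst; apply: nearW => n; apply: integral0_eq => x Bx.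
  by rewrite phi0 ?subrr ?expr0n//; exact: bdry_openC Bx.
Qed.

End traces.

(** * The least-squares estimator *)

Section least_squares.
Context (R : realType) (d : nat) (Om : set 'rV[R]_d) (oOm : open Om).
Notation E := 'rV[R]_d.
Implicit Types (f g h : E -> R) (F G : E -> E).
Local Notation mu := (leb R d).
Local Notation integrable f := (mu.-integrable Om (fun x => (f x)%:E)).
Local Notation Int f := (\int[mu]_(x in Om) (f x))%R.
Let mOm := measurable_domain oOm.

(** The real-valued integral sends +oo to 0, so monotonicity requires the larger integral to be
    finite. As f may be non-measurable, this applies to the weighted residual. *)
Lemma le_Rintegral_ae f g : (forall x, 0 <= f x) -> (forall x, 0 <= g x) ->
  (\int[mu]_(x in Om) (g x)%:E < +oo)%E ->
  (\forall x \ae mu, Om x -> f x <= g x) -> Int f <= Int g.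
Proof.
move=> f0 g0 goo fg; have fg' := le_integral_ae f0 g0 fg.
have pos k : (forall x, 0 <= k x) -> (0 <= \int[mu]_(x in Om) (k x)%:E)%E.
  by move=> k0; apply: integral_ge0 => x _; rewrite lee_fin.
apply: fine_le => //; rewrite ge0_fin_numE ?pos//.
exact: le_lt_trans goo.
Qed.

Lemma integrable_addR f g : integrable f -> integrable g ->
  integrable (fun x => f x + g x).
Proof.
by move=> fi gi; under eq_fun do rewrite EFinD; exact: integrableD.
Qed.

Lemma integrable_scaleR (k : R) f : integrable f ->
  integrable (fun x => k * f x).
Proof.
by move=> fi; under eq_fun do rewrite EFinM; exact: integrableZl.
Qed.

Lemma le_Int_comb (k1 k2 k3 : R) f f1 f2 f3 :
  integrable f -> integrable f1 -> integrable f2 -> integrable f3 ->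
  (\forall x \ae mu, Om x -> f x <= k1 * f1 x + k2 * f2 x + k3 * f3 x) ->
  Int f <= k1 * Int f1 + k2 * Int f2 + k3 * Int f3.
Proof.
move=> fi i1 i2 i3 ff.
have i1' := integrable_scaleR k1 i1.
have i2' := integrable_scaleR k2 i2.
have i3' := integrable_scaleR k3 i3.
have i12 := integrable_addR i1' i2'.
apply: le_trans (le_Int mOm fi (integrable_addR i12 i3') ff) _.
rewrite (RintegralD mOm i12 i3') (RintegralD mOm i1' i2').
by rewrite (RintegralZl _ mOm i1) (RintegralZl _ mOm i2) (RintegralZl _ mOm i3).
Qed.

(** * The bilinear form and the flux of the adjoint solution *)

Section coefficients.
Context (GD GN : set E) (A : E -> 'M[R]_d) (b : E -> E) (c : E -> R).
Context (a0 a1 : R) (ellA : elliptic Om A a0 a1).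
Context (bL : forall i, Linf mu Om (fun x => b x 0 i)) (cL : Linf mu Om c).

Let AL : forall i j, Linf mu Om (fun x => A x i j).
Proof. by case: ellA. Qed.

(** Moving all coefficients onto v, by the symmetry of A, exposes the flux A grad v + v b of the
    adjoint operator. *)
Lemma aformE (s v : H1 Om) : aform A b c s v =
  Int (fun x => dot (h1_grad s x) (mxact (A x) (h1_grad v x) + v x *: b x)) +
  Int (fun x => s x * (c x * v x)).
Proof.
have s2 := h1_fun_L2 s; have v2 := h1_fun_L2 v.
have gs2 := @h1_grad_L2 _ _ _ s; have gv2 := @h1_grad_L2 _ _ _ v.
have i1 : integrable (fun x => dot (mxact (A x) (h1_grad s x)) (h1_grad v x)).
  exact: (integrable_dot oOm (L2vec_mxact oOm AL gs2)).
have i2 : integrable (fun x => dot (b x) (h1_grad s x) * v x).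
  exact: (integrable_L2M mOm (L2_dot_Linf oOm bL gs2)).
have i3 : integrable (fun x => s x * (c x * v x)).
  exact: (integrable_L2M mOm s2 (LinfM mOm cL v2)).
have i4 : integrable (fun x => dot (h1_grad s x) (mxact (A x) (h1_grad v x))).
  exact: (integrable_dot oOm gs2 (L2vec_mxact oOm AL gv2)).
have i5 : integrable (fun x => dot (h1_grad s x) (v x *: b x)).
  exact: (integrable_dot oOm gs2 (L2vec_scale oOm bL v2)).
rewrite /aform /ipvec /ip.
have -> : Int (fun x => (dot (b x) (h1_grad s x) + c x * s x) * v x) =
    Int (fun x => dot (h1_grad s x) (v x *: b x)) +
    Int (fun x => s x * (c x * v x)).
  rewrite -RintegralD//; apply: eq_Rintegral => x _.
  by rewrite dotZr (dotC (h1_grad s x)); ring.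
have -> : Int (fun x => dot (mxact (A x) (h1_grad s x)) (h1_grad v x)) =
    Int (fun x => dot (h1_grad s x) (mxact (A x) (h1_grad v x))).
  apply: (eq_Int mOm) => //; case: ellA => _ + _ _ _.
  by apply: filterS => x sA Ox; rewrite dot_mxact// sA.
rewrite addrA -(RintegralD mOm i4 i5); congr (_ + _).
by apply: eq_Rintegral => x _; rewrite dotDr.
Qed.

Section adjoint.
Context (g1 : E -> R) (g2 : E -> E) (psid phid : E -> R) (z : H1 Om).
Context (g1L : L2 mu Om g1) (g2L : L2vec Om g2).
Hypothesis zsol : adjoint_solution GD GN A b c g1 g2 psid phid z.

Let flux x := - (mxact (A x) (h1_grad z x) + z x *: b x + g2 x).
Let fdiv x := g1 x - c x * z x.

Let AzL : L2vec Om (fun x => mxact (A x) (h1_grad z x) + z x *: b x).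
Proof.
apply: (L2vecD oOm (L2vec_mxact oOm AL (@h1_grad_L2 _ _ _ z))).
exact: (L2vec_scale oOm bL (h1_fun_L2 z)).
Qed.

Let fluxL : L2vec Om flux.
Proof. exact: (L2vecN oOm (L2vecD oOm AzL g2L)). Qed.

Let fdivL : L2 mu Om fdiv.
Proof. exact: (L2B mOm g1L (LinfM mOm cL (h1_fun_L2 z))). Qed.

(** Stated for plain functions, since [flux] is not yet known to have [fdiv] as its divergence. Test
    functions, for which the right side is 0, yield exactly that; general s yield the normal
    trace. *)
Lemma adjoint_flux (s : H1 Om) (t : E -> R) : H1D GD s -> is_trace s t ->
  ipvec Om flux (h1_grad s) + ip Om fdiv s = bdry_pairing GN psid t.
Proof.
move=> sD st; have := zsol.2 s sD t st; rewrite aformE /mform.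
have s2 := h1_fun_L2 s; have gs2 := @h1_grad_L2 _ _ _ s.
have -> : ipvec Om flux (h1_grad s) = - (Int (fun x => dot (h1_grad s x)
    (mxact (A x) (h1_grad z x) + z x *: b x)) + ipvec Om g2 (h1_grad s)).
  rewrite -RintegralD//; last 2 first.
  - exact: (integrable_dot oOm).
  - exact: (integrable_dot oOm).
  rewrite -mulN1r -RintegralZl//; last first.
    by apply: integrable_addR; exact: (integrable_dot oOm).
  apply: eq_Rintegral => x _.
  by rewrite /flux dotNl dotDl mulN1r (dotC (h1_grad s x)).
have -> : ip Om fdiv s = ip Om g1 s - Int (fun x => s x * (c x * z x)).
  rewrite -RintegralB//; last 2 first.
  - exact: (integrable_L2M mOm).
  - exact: (integrable_L2M mOm s2 (LinfM mOm cL (h1_fun_L2 z))).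
  by apply: eq_Rintegral => x _; rewrite /fdiv; ring.
lra.
Qed.

Lemma adjoint_Hdiv : exists r : Hdiv Om,
  [/\ forall x, r x = - (mxact (A x) (h1_grad z x) + z x *: b x + g2 x),
      forall x, hdiv_div r x = g1 x - c x * z x & Sigmad GD GN psid r].
Proof.
have divP : is_weak_div Om flux fdiv.
  move=> phi tphi; have [w [wE gwE w0]] := test_fun_H1 oOm tphi.
  have wD : H1D GD w by exists (fun=> 0); split => //; exact: aeW.
  have := adjoint_flux wD w0.
  rewrite (funext wE : h1_fun w = phi) (funext gwE : h1_grad w = grad phi).
  rewrite {1}/bdry_pairing /Rintegral integral0_eq => [|x _];
    last by rewrite mulr0.
  by move/eqP; rewrite addr_eq0 => /eqP.
exists (MkHdiv fluxL fdivL divP); split => // s sD t st.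
exact: adjoint_flux.
Qed.

End adjoint.

(** * Control of w by the residuals through the inf-sup condition *)

Section stability.
Context (q : E -> E) (dq : E -> R) (w : H1 Om).
Context (qL : L2vec Om q) (dqL : L2 mu Om dq).

(** This is y of the overview, and [div_defect] is e. Here q and dq are merely square-integrable;
    the lemmas on the form link them by orthogonality to H^1_D. *)
Definition flux_defect x := q x + mxact (A x) (h1_grad w x) + w x *: b x.

Definition div_defect x := dq x + c x * w x.

Lemma flux_defect_L2 : L2vec Om flux_defect.
Proof.
apply: (L2vecD oOm (L2vecD oOm qL _)).
  exact: (L2vec_mxact oOm AL (@h1_grad_L2 _ _ _ w)).
exact: (L2vec_scale oOm bL (h1_fun_L2 w)).
Qed.

Lemma div_defect_L2 : L2 mu Om div_defect.
Proof. exact: (L2D mOm dqL (LinfM mOm cL (h1_fun_L2 w))). Qed.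

Lemma aform_defect (s : H1 Om) :
  ipvec Om q (h1_grad s) + ip Om dq s = 0 ->
  aform A b c s w = Int (fun x => dot (h1_grad s x) (flux_defect x)) +
    Int (fun x => s x * div_defect x).
Proof.
have s2 := h1_fun_L2 s; have gs2 := @h1_grad_L2 _ _ _ s.
have i1 := integrable_dot oOm qL gs2.
have i2 := integrable_L2M mOm dqL s2.
have yL : L2vec Om (fun x => mxact (A x) (h1_grad w x) + w x *: b x).
  apply: (L2vecD oOm (L2vec_mxact oOm AL (@h1_grad_L2 _ _ _ w))).
  exact: (L2vec_scale oOm bL (h1_fun_L2 w)).
have i3 := integrable_dot oOm gs2 yL.
have i4 := integrable_L2M mOm s2 (LinfM mOm cL (h1_fun_L2 w)).
rewrite aformE /ipvec /ip => q0.
have -> : Int (fun x => dot (h1_grad s x) (flux_defect x)) =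
    Int (fun x => dot (q x) (h1_grad s x)) +
    Int (fun x => dot (h1_grad s x) (mxact (A x) (h1_grad w x) + w x *: b x)).
  rewrite -(RintegralD mOm i1 i3); apply: eq_Rintegral => x _.
  by rewrite /flux_defect -addrA !dotDr (dotC (q x)).
have -> : Int (fun x => s x * div_defect x) =
    Int (fun x => dq x * s x) + Int (fun x => s x * (c x * w x)).
  rewrite -(RintegralD mOm i2 i4); apply: eq_Rintegral => x _.
  by rewrite /div_defect; ring.
by lra.
Qed.

Lemma aform_le_defect (s : H1 Om) :
  ipvec Om q (h1_grad s) + ip Om dq s = 0 ->
  aform A b c s w <=
    Num.sqrt (Int (fun x => dot (flux_defect x) (flux_defect x)) +
              Int (fun x => div_defect x * div_defect x)) * h1_norm s.
Proof.
move=> /aform_defect ->.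
have s2 := h1_fun_L2 s; have gs2 := @h1_grad_L2 _ _ _ s.
have Int_sq_ge0 F : 0 <= Int (fun x => dot (F x) (F x)).
  by apply: Rintegral_ge0 => x _; exact: dot_ge0.
have Int_sq_ge0' f : 0 <= Int (fun x => f x * f x).
  by apply: Rintegral_ge0 => x _; rewrite -expr2 sqr_ge0.
apply: sqrt_mul_ge; [by apply: addr_ge0|
  exact: addr_ge0 (Int_sq_ge0' s) (Int_sq_ge0 (h1_grad s))|move=> k k0].
have yy := integrable_dot oOm flux_defect_L2 flux_defect_L2.
have gg := integrable_dot oOm gs2 gs2.
have ee := integrable_L2M mOm div_defect_L2 div_defect_L2.
have ss := integrable_L2M mOm s2 s2.
(* [le_Int_comb] takes three terms; the third one is filled with a dummy of coefficient 0. *)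
have h1 := @le_Int_comb (k / 2) (k^-1 / 2) 0 _ _ _ _
  (integrable_dot oOm gs2 flux_defect_L2) yy gg gg.
have h2 := @le_Int_comb (k / 2) (k^-1 / 2) 0 _ _ _ _
  (integrable_L2M mOm s2 div_defect_L2) ee ss ss.
have := lerD (h1 _) (h2 _).
rewrite !mul0r !addr0 => h; apply: le_trans (h _ _) _.
- apply: aeW => x _; apply: le_trans (dot_le _ _ k0) _; lra.
- apply: aeW => x _.
  have := sqr_ge0 (s x - k * div_defect x) => h'.
  have : 0 <= k^-1 * (s x - k * div_defect x) ^+ 2.
    by rewrite mulr_ge0 ?sqr_ge0// invr_ge0 ltW.
  rewrite (_ : k^-1 * _ = k^-1 * (s x * s x) - 2 * (s x * div_defect x) +
    k * (div_defect x * div_defect x)); last by field; rewrite gt_eqF.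
  lra.
- by rewrite /ip /ipvec; lra.
Qed.

Lemma infsup_defect (beta : R) : inf_sup Om GD A b c beta -> H1D GD w ->
  (forall s : H1 Om, H1D GD s -> ipvec Om q (h1_grad s) + ip Om dq s = 0) ->
  beta * h1_norm w <=
    Num.sqrt (Int (fun x => dot (flux_defect x) (flux_defect x)) +
              Int (fun x => div_defect x * div_defect x)).
Proof.
move=> [beta0 _ betaE] wD q0; set Y := Num.sqrt _.
have n0 (s : H1 Om) : 0 <= h1_norm s by exact: sqrtr_ge0.
(* The infimum ranges over nonzero norms only. As w is the second argument of the form, [betaE] is
   the identity whose supremum runs over the first argument. *)
have [w0|w0] := eqVneq (h1_norm w) 0; first by rewrite w0 mulr0 sqrtr_ge0.
have wp : 0 < h1_norm w by rewrite lt_def w0 n0.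
rewrite -ler_pdivlMr// -lee_fin betaE.
apply: le_trans (ereal_inf_lbound _) _; first by exists w; [split|reflexivity].
apply: ge_ereal_sup => _ [s [sD s0] <-]; rewrite /aquot lee_fin.
have sp : 0 < h1_norm s by rewrite lt_def s0 n0.
rewrite invfM mulrA ler_pM2r ?invr_gt0// ler_pdivrMr//.
exact/aform_le_defect/q0.
Qed.

End stability.
End coefficients.
End least_squares.

(** * Equivalence of residual energy and error norm *)

Section norm_equivalence.
Context (R : realType) (d : nat) (Om : set 'rV[R]_d) (oOm : open Om).
Notation E := 'rV[R]_d.
Local Notation mu := (leb R d).
Local Notation Int f := (\int[mu]_(x in Om) (f x))%R.
Let mOm := measurable_domain oOm.

(** The terms in z and g2 cancel between q and the flux of w. The identity is pointwise because the
    square root has a meaning only at good points x. *)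
Lemma eta_res1_defect (A : E -> 'M[R]_d) (b g2 : E -> E) (a0 a1 : R)
    (z v w : H1 Om) (rho : Hdiv Om) (q : E -> E) (x : E) :
  (A x)^T = A x -> 0 < a0 ->
  (forall u, a0 * dot u u <= dot u (mxact (A x) u) <= a1 * dot u u) ->
  w x = z x - v x -> h1_grad w x = h1_grad z x - h1_grad v x ->
  q x = - (mxact (A x) (h1_grad z x) + z x *: b x + g2 x) - rho x ->
  eta_res1 A b g2 rho v x =
    mxact (sqrtmxV (A x)) (- flux_defect A b q w x).
Proof.
move=> sA a00 Ab wE gwE qE; rewrite /eta_res1 (mxact_sqrtmxV sA a00 Ab)
  -!mxactD.
congr (mxact _ _); rewrite /flux_defect qE wE gwE mxactD mxactN scalerBl.
by apply/rowP => i; rewrite !(mxE, mxactD); ring.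
Qed.

Lemma ler_sqrt_scale (k x y : R) : 0 <= k -> x <= k * y ->
  Num.sqrt x <= Num.sqrt k * Num.sqrt y.
Proof. by move=> k0 xy; rewrite -sqrtrM// ler_wsqrtr. Qed.

(** The weight affects the flux residual but not the divergence residual; k + 1 is a common factor
    for both. *)
Lemma ler_add_scale (k x y e : R) : 0 <= k -> 0 <= y -> 0 <= e ->
  x <= k * y -> x + e <= (k + 1) * (y + e).
Proof. by move=> k0 y0 e0 xy; have := mulr_ge0 k0 e0; lra. Qed.

Lemma energy_equivalence (A : E -> 'M[R]_d) (b : E -> E) (c : E -> R)
    (a0 a1 beta : R) (GD : set E) :
  elliptic Om A a0 a1 ->
  (forall i, Linf mu Om (fun x => b x 0 i)) -> Linf mu Om c ->
  inf_sup Om GD A b c beta ->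
  exists KL KU : R, [/\ 0 < KL, 0 < KU &
    forall (q : E -> E) (dq : E -> R) (w : H1 Om),
    L2vec Om q -> L2 mu Om dq -> H1D GD w ->
    (forall s : H1 Om, H1D GD s -> ipvec Om q (h1_grad s) + ip Om dq s = 0) ->
    let Y := Int (fun x => dot (flux_defect A b q w x) (flux_defect A b q w
      x)) in
    let D := Int (fun x => div_defect c dq w x * div_defect c dq w x) in
    let Z := ipvec Om q q + ip Om dq dq +
      (ip Om w w + ipvec Om (h1_grad w) (h1_grad w)) in
    Z <= KL * (Y + D) /\ Y + D <= KU * Z].
Proof.
move=> ellA bL cL isup.
have [B [B0 bB]] := Linf_vec_bound bL.
have [C [C0 cC]] := Linf_bound cL.
have [_ sA a0_gt0 a01 Ab] := ellA.
have beta0 : 0 < beta by case: isup.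
have a10 := sqr_ge0 a1.
(* The factors 3 and 2 come from squaring sums of three and two terms. In the first constant,
   recovering q and dq costs multiples of ||w||_1^2, which the inf-sup bound replaces by beta^-2 (Y
   + D). The second adds up all coefficients, with 5 = 3 + 2. *)
exists (3 + (1 + 3 * a1 ^+ 2 + 3 * B + 2 * C) * beta ^- 2),
  (5 + 3 * a1 ^+ 2 + 3 * B + 2 * C); split.
- rewrite ltr_wpDr// mulr_ge0 ?invr_ge0 ?exprn_ge0 ?ltW//; lra.
- lra.
move=> q dq w qL dqL wD q0 Y D Z.
have w2 := h1_fun_L2 w; have gw2 := @h1_grad_L2 _ _ _ w.
have yL := flux_defect_L2 oOm ellA bL w qL.
have eL := div_defect_L2 oOm cL w dqL.
have yy := integrable_dot oOm yL yL.
have ee := integrable_L2M mOm eL eL.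
have qq := integrable_dot oOm qL qL.
have dd := integrable_L2M mOm dqL dqL.
have ww := integrable_L2M mOm w2 w2.
have pp := integrable_dot oOm gw2 gw2.
have flux_le : \forall x \ae mu, Om x ->
    dot (mxact (A x) (h1_grad w x)) (mxact (A x) (h1_grad w x)) +
    dot (w x *: b x) (w x *: b x) <=
    a1 ^+ 2 * dot (h1_grad w x) (h1_grad w x) + B * (w x * w x).
  apply: filterS3 sA Ab bB => x sA Ab bB Ox; apply: lerD.
    exact: (dot_mxact_le (sA Ox) a0_gt0 (Ab Ox)).
  rewrite dotZl dotZr mulrA mulrC ler_wpM2r//; last exact: bB.
  by rewrite -expr2 sqr_ge0.
have YE : Y <= 3 * ipvec Om q q + (3 * a1 ^+ 2) * ipvec Om (h1_grad w)
  (h1_grad w) +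
    (3 * B) * ip Om w w.
  apply: (le_Int_comb oOm yy qq pp ww); apply: filterS flux_le => x h Ox.
  by have := dot_sum3_le (q x) (mxact (A x) (h1_grad w x)) (w x *: b x);
    rewrite -/(flux_defect A b q w x); have := h Ox; lra.
have QE : ipvec Om q q <= 3 * Y +
    (3 * a1 ^+ 2) * ipvec Om (h1_grad w) (h1_grad w) + (3 * B) * ip Om w w.
  apply: (le_Int_comb oOm qq yy pp ww); apply: filterS flux_le => x h Ox.
  have := dot_sum3_le (flux_defect A b q w x)
    (- mxact (A x) (h1_grad w x)) (- (w x *: b x)).
  rewrite -addrA -opprD /flux_defect -[X in X - _]addrA addrK.
  by rewrite !dotNl !dotNr !opprK; have := h Ox; lra.
have DE : D <= 2 * ip Om dq dq + (2 * C) * ip Om w w + 0 * ip Om w w.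
  apply: (le_Int_comb oOm ee dd ww ww); apply: filterS cC => x h Ox.
  have := sqr_ge0 (dq x - c x * w x).
  have : c x ^+ 2 * (w x) ^+ 2 <= C * (w x) ^+ 2 by rewrite ler_wpM2r ?sqr_ge0
    ?h.
  by rewrite /div_defect; lra.
have dE : ip Om dq dq <= 2 * D + (2 * C) * ip Om w w + 0 * ip Om w w.
  apply: (le_Int_comb oOm dd ee ww ww); apply: filterS cC => x h Ox.
  have := sqr_ge0 (div_defect c dq w x + c x * w x).
  have : c x ^+ 2 * (w x) ^+ 2 <= C * (w x) ^+ 2 by rewrite ler_wpM2r ?sqr_ge0
    ?h.
  by rewrite /div_defect; lra.
have Idot_ge0 F : 0 <= ipvec Om F F.
  by apply: Rintegral_ge0 => x _; exact: dot_ge0.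
have Isq_ge0 (f : E -> R) : 0 <= ip Om f f.
  by apply: Rintegral_ge0 => x _; rewrite -expr2 sqr_ge0.
have Y0 : 0 <= Y by exact: Idot_ge0.
have D0 : 0 <= D by exact: Isq_ge0.
have wn := infsup_defect oOm ellA bL cL qL dqL isup wD q0.
have {wn} wn : beta ^+ 2 * (ip Om w w + ipvec Om (h1_grad w) (h1_grad w)) <= Y
  + D.
  rewrite -[leRHS]sqr_sqrtr ?addr_ge0// -[X in _ * X]sqr_sqrtr ?addr_ge0//.
  by rewrite -exprMn lerXn2r// nnegrE ?sqrtr_ge0// mulr_ge0 ?sqrtr_ge0// ltW.
have Q0 := Idot_ge0 q; have d0 := Isq_ge0 dq.
have W0 := Isq_ge0 w; have P0 := Idot_ge0 (h1_grad w).
have {wn} wn : ip Om w w + ipvec Om (h1_grad w) (h1_grad w) <= beta ^- 2 * (Y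
  + D).
  by rewrite ler_pdivlMl ?exprn_gt0.
rewrite /Z; move: (ipvec Om q q) (ip Om dq dq) (ip Om w w) (ipvec Om _ _)
  Q0 d0 W0 P0 YE QE DE dE wn => Q' D' W P Q0 d0 W0 P0 YE QE DE dE wn.
(* Signs of the cross products that arise when the constants are multiplied out; [lra] treats these
   products as atoms. *)
have a1W := mulr_ge0 a10 W0; have BP := mulr_ge0 B0 P0;
  have CP := mulr_ge0 C0 P0.
have a1Q := mulr_ge0 a10 Q0; have BQ := mulr_ge0 B0 Q0;
  have CQ := mulr_ge0 C0 Q0.
have a1D := mulr_ge0 a10 d0; have BD := mulr_ge0 B0 d0;
  have CD := mulr_ge0 C0 d0.
have a1P := mulr_ge0 a10 P0; have BW := mulr_ge0 B0 W0;
  have CW := mulr_ge0 C0 W0.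
split; last by lra.
have L0 : 0 <= 1 + 3 * a1 ^+ 2 + 3 * B + 2 * C by lra.
have := ler_wpM2l L0 wn.
by lra.
Qed.

End norm_equivalence.

Theorem theorem5p4 (R : realType) (d : nat) (Om GD GN : set 'rV[R]_d)
  (A : 'rV[R]_d -> 'M[R]_d) (b : 'rV[R]_d -> 'rV[R]_d) (c : 'rV[R]_d -> R)
  (g1 : 'rV[R]_d -> R) (g2 : 'rV[R]_d -> 'rV[R]_d)
  (psid phid : 'rV[R]_d -> R) (a0 a1 beta : R) (z : H1 Om) :
  (2 <= d)%N ->
  bounded_lipschitz_domain Om ->
  rel_open (bdry Om) GD -> rel_open (bdry Om) GN -> GD `&` GN = set0 ->
  bdry Om = closure GD `|` closure GN ->
  (0 < surf GD)%E ->
  elliptic Om A a0 a1 ->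
  (forall i, Linf (leb R d) Om (fun x => b x 0 i)) ->
  Linf (leb R d) Om c ->
  L2 (leb R d) Om g1 ->
  L2vec Om g2 ->
  L2 (@surf R d) GN psid ->
  Hhalf Om GD phid ->
  (exists rho : Hdiv Om, Sigmad GD GN psid rho) ->
  inf_sup Om GD A b c beta ->
  adjoint_solution GD GN A b c g1 g2 psid phid z ->
  exists r : Hdiv Om,
    (forall x, r x = - (mxact (A x) (h1_grad z x) + z x *: b x + g2 x)) /\
    exists c1 C1 : R, 0 < c1 /\ 0 < C1 /\
      forall (rho : Hdiv Om) (v : H1 Om),
        Sigmad GD GN psid rho -> Xd GD phid v ->
        c1 * err_norm r rho z v <= eta_LS A b c g1 g2 rho v
          <= C1 * err_norm r rho z v.
Proof.
move=> _ [oOm _ _ _ _] _ _ _ _ _ ellA bL cL g1L g2L _ _ _ isup zsol.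
have mOm := measurable_domain oOm.
have [r [rE drE rS]] := adjoint_Hdiv oOm ellA bL cL g1L g2L zsol.
exists r; split => //.
have [KL [KU [KL0 KU0 equiv]]] := energy_equivalence oOm ellA bL cL isup.
have [_ sA a0_gt0 a01 Ab] := ellA.
have a1_gt0 : 0 < a1 := lt_le_trans a0_gt0 a01.
(* With N the weighted flux energy, Y <= a1 N and N <= a0^-1 Y are combined with the equivalence of
   Y + D and Z; the +1 accounts for D. *)
pose kL := KL * (a1 + 1); pose kU := (a0^-1 + 1) * KU.
have kL0 : 0 < kL by rewrite mulr_gt0 ?ltr_wpDl ?ltW.
have kU0 : 0 < kU by rewrite mulr_gt0 ?ltr_wpDl ?invr_ge0 ?ltW.
exists (Num.sqrt kL)^-1, (Num.sqrt kU).
rewrite invr_gt0 !sqrtr_gt0; do 2 split => //.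
move=> rho v rhoS vX.
have [w [wE gwE]] := H1_sub z v oOm.
pose q x := r x - rho x; pose dq x := hdiv_div r x - hdiv_div rho x.
have qL : L2vec Om q := L2vecB oOm (@hdiv_fun_L2 _ _ _ r) (@hdiv_fun_L2 _ _ _
  rho).
have dqL : L2 (leb R d) Om dq := L2B mOm (hdiv_div_L2 r) (hdiv_div_L2 rho).
have wD : H1D GD w := eq_on_sub oOm wE gwE zsol.1 vX.
(* Membership in H^1_D supplies a trace of s; r and rho have the same normal trace against it, so
   the boundary terms cancel. *)
have q0 (s : H1 Om) : H1D GD s -> ipvec Om q (h1_grad s) + ip Om dq s = 0.
  move=> sD; have [t [st _]] := sD.
  have rs := rS s sD t st; have rhos := rhoS s sD t st.
  have -> : ipvec Om q (h1_grad s) = ipvec Om r (h1_grad s) - ipvec Om rho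
    (h1_grad s).
    rewrite -(RintegralB mOm
      (integrable_dot oOm (@hdiv_fun_L2 _ _ _ r) (@h1_grad_L2 _ _ _ s))
      (integrable_dot oOm (@hdiv_fun_L2 _ _ _ rho) (@h1_grad_L2 _ _ _ s))).
    by apply: eq_Rintegral => x _; rewrite dotDl dotNl.
  have -> : ip Om dq s = ip Om (hdiv_div r) s - ip Om (hdiv_div rho) s.
    rewrite -(RintegralB mOm (integrable_L2M mOm (hdiv_div_L2 r) (h1_fun_L2 s))
      (integrable_L2M mOm (hdiv_div_L2 rho) (h1_fun_L2 s))).
    by apply: eq_Rintegral => x _; rewrite mulrBl.
  by move: rs rhos; lra.
have := equiv q dq w qL dqL wD q0.
set Y := (\int[_]_(x in _) _)%R; set D := (\int[_]_(x in _) _)%R => /=.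
set Z := ipvec Om q q + _ + _ => -[ZL ZU].
have -> : err_norm r rho z v = Num.sqrt Z.
  by rewrite /Z (funext wE : h1_fun w = _) (funext gwE : h1_grad w = _).
have -> : eta_LS A b c g1 g2 rho v =
    Num.sqrt (ipvec Om (eta_res1 A b g2 rho v) (eta_res1 A b g2 rho v) + D).
  congr (Num.sqrt (_ + _)); apply: eq_Rintegral => x _.
  by rewrite /eta_res2 /div_defect /dq drE wE; ring.
set N := ipvec Om _ _.
have yL := flux_defect_L2 oOm ellA bL w qL.
have yy := integrable_dot oOm yL yL.
pose ny x := dot (flux_defect A b q w x) (flux_defect A b q w x).
pose n1 x := dot (eta_res1 A b g2 rho v x) (eta_res1 A b g2 rho v x).
have n1_bounds : \forall x \ae leb R d, Om x ->
    a1^-1 * ny x <= n1 x /\ n1 x <= a0^-1 * ny x.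
  apply: filterS2 sA Ab => x /[swap] Ab /[swap] Ox /(_ Ox) sA.
  have := eta_res1_defect (q := q) (rho := rho) (g2 := g2) (b := b) sA a0_gt0
    (Ab Ox)
    (wE x) (gwE x) _.
  rewrite /n1 => ->; last by rewrite /q rE.
  have := sqrtmxV_bounds sA a0_gt0 (Ab Ox) (- flux_defect A b q w x).
  rewrite dotNl dotNr opprK => /andP[h1 h2]; split.
    by rewrite ler_pdivrMl.
  by rewrite ler_pdivlMl.
have ny0 x : 0 <= ny x by exact: dot_ge0.
have n10 x : 0 <= n1 x by exact: dot_ge0.
have scale0 (k : R) x : 0 < k -> 0 <= k^-1 * ny x.
  by move=> k0; rewrite mulr_ge0// invr_ge0 ltW.
have iny k : (leb R d).-integrable Om (fun x => (k * ny x)%:E).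
  exact: integrable_scaleR.
have ny_fin k : 0 < k -> (\int[leb R d]_(x in Om) (k^-1 * ny x)%:E < +oo)%E.
  move=> k0; have /integrableP[_] := iny k^-1; apply: le_lt_trans.
  rewrite le_eqVlt; apply/predU1P; left; apply: eq_integral => x _.
  by rewrite gee0_abs// lee_fin scale0.
(* In the lower bound n1 is the majorant, so its integral must first be known to be finite. *)
have n1_fin : (\int[leb R d]_(x in Om) (n1 x)%:E < +oo)%E.
  apply: le_lt_trans (ny_fin a0 a0_gt0).
  apply: le_integral_ae => //; first by move=> x; exact: scale0.
  by apply: filterS n1_bounds => x h /h[].
have NU : N <= a0^-1 * Y.
  rewrite -(RintegralZl _ mOm yy); apply: le_Rintegral_ae => //.
  - by move=> x; exact: scale0.
  - exact: ny_fin.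
  - by apply: filterS n1_bounds => x h /h[].
have NL : a1^-1 * Y <= N.
  rewrite -(RintegralZl _ mOm yy); apply: le_Rintegral_ae => //.
  - by move=> x; exact: scale0.
  - by apply: filterS n1_bounds => x h /h[].
have Y0 : 0 <= Y by apply: Rintegral_ge0 => x _; exact: ny0.
have N0 : 0 <= N by apply: Rintegral_ge0 => x _; exact: n10.
have D0 : 0 <= D by apply: Rintegral_ge0 => x _; rewrite -expr2 sqr_ge0.
apply/andP; split; last first.
  apply: ler_sqrt_scale; first exact: ltW.
  rewrite /kU -mulrA; have a0V : 0 <= a0^-1 by rewrite invr_ge0 ltW.
  apply: le_trans (ler_add_scale a0V Y0 D0 NU) _.
  by rewrite ler_wpM2l// addr_ge0.
rewrite ler_pdivrMl ?sqrtr_gt0//; apply: ler_sqrt_scale; first exact: ltW.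
apply: le_trans ZL _; rewrite /kL -mulrA ler_pM2l//.
apply: (ler_add_scale (ltW a1_gt0) N0 D0).
by rewrite -ler_pdivrMl.
Qed.
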